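(* Let $n_t,n_r\in\mathbb{N}$, let $\mathcal{X}\subset\mathbb{R}^{n_t}$ be a convex and compact set containing the origin, and let $\mathsf{H}\in\mathbb{R}^{n_r\times n_t}$ be any fixed matrix. Then $$C(\mathcal{X},\mathsf{H})\ge\max_{F_{\mathbf{X}}:\mathbf{X}\in\mathcal{X}}\log^+\left(\left(\frac{2}{e}\right)^{\frac{n_r}{2}}\mathbb{E}\left[\exp\left(-\frac{\|\mathsf{H}(\mathbf{X}-\mathbf{X}')\|^2}{4}\right)\right]^{-1}\right),$$ where the maximum is over all distributions of random vectors $\mathbf{X}$ taking values in $\mathcal{X}$ and $\mathbf{X}'$ is an independent copy of $\mathbf{X}$.
   Context: All logarithms are to base $2$ (while $\exp$ is the natural exponential), and $\log^+(x):=\max\{\log(x),0\}$; mutual information is measured in bits. The channel is $\mathbf{Y}=\mathsf{H}\mathbf{X}+\mathbf{Z}$, where $\mathbf{Z}\sim\mathcal{N}(\mathbf{0},\mathsf{I}_{n_r})$ is independent of the input $\mathbf{X}\in\mathbb{R}^{n_t}$. The capacity is $$C(\mathcal{X},\mathsf{H}):=\max_{F_{\mathbf{X}}:\mathbf{X}\in\mathcal{X}}I(\mathbf{X};\mathsf{H}\mathbf{X}+\mathbf{Z}),$$ the maximum being over all distributions $F_{\mathbf{X}}$ of random vectors $\mathbf{X}$ taking values in $\mathcal{X}$. $\|\cdot\|$ is the Euclidean norm. *)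

(* Defs.v *)
From HB Require Import structures.
From mathcomp Require Import all_boot all_order all_algebra.
From mathcomp Require Import all_classical all_reals all_analysis.
From mathcomp Require Import measurable_realfun.

Set Implicit Arguments.
Unset Strict Implicit.
Unset Printing Implicit Defensive.

Import Order.TTheory GRing.Theory Num.Theory.
Import numFieldNormedType.Exports.

Local Open Scope classical_set_scope.
Local Open Scope ring_scope.

(** On matrices we use the sigma-algebra generated by the entries; over a
    [realType] this is the Borel sigma-algebra. *)
Definition measure_matrix_display : measure_display -> measure_display.
Proof. exact. Qed.

Section measurable_matrix.
Context {d} {T : measurableType d} (m n : nat).

Definition entry_measurable : set (set 'M[T]_(m, n)) :=
  <<s \bigcup_(ij in [set: 'I_m * 'I_n])
        preimage_set_system setT (fun M : 'M[T]_(m, n) => M ij.1 ij.2)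
          measurable >>.

Let entry0 : entry_measurable set0.
Proof. exact: sigma_algebra0. Qed.

Let entryC A : entry_measurable A -> entry_measurable (~` A).
Proof. exact: sigma_algebraC. Qed.

Let entry_bigcup (F : (set 'M[T]_(m, n))^nat) :
  (forall i, entry_measurable (F i)) -> entry_measurable (\bigcup_i F i).
Proof. exact: sigma_algebra_bigcup. Qed.

HB.instance Definition _ := @isMeasurable.Build (measure_matrix_display d)
  'M[T]_(m, n) entry_measurable entry0 entryC entry_bigcup.

Lemma measurable_entry (i : 'I_m) (j : 'I_n) :
  measurable_fun [set: 'M[T]_(m, n)] (fun M : 'M[T]_(m, n) => M i j).
Proof.
by move=> _ A mA; apply: sub_sigma_algebra; exists (i, j) => //; exists A.
Qed.

Lemma measurable_fun_matrix d' (U : measurableType d') (f : U -> 'M[T]_(m, n)) :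
  (forall i j, measurable_fun [set: U] (fun u => f u i j)) ->
  measurable_fun [set: U] f.
Proof.
move=> mf _ A mA.
suff : entry_measurable `<=` [set B | measurable ([set: U] `&` f @^-1` B)].
  exact.
apply: smallest_sub.
  split => /=; first by rewrite preimage_set0 setI0.
    move=> B mB; rewrite setTD preimage_setC setTI.
    by apply: measurableC; rewrite -[X in measurable X]setTI.
  move=> F mF; rewrite preimage_bigcup setI_bigcupr.
  exact: bigcup_measurable.
by move=> _ [[i j] _ [B mB <-]] /=; rewrite setTI; exact: mf.
Qed.

End measurable_matrix.

Section product_probability.
Context d1 d2 (T1 : measurableType d1) (T2 : measurableType d2) (R : realType).
Variables (P : probability T1 R) (Q : probability T2 R).

Definition product_prob : set (T1 * T2) -> \bar R := (P \x Q)%E.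

HB.instance Definition _ := Measure.on product_prob.

Let product_prob_setT : product_prob setT = 1%E.
Proof.
rewrite /product_prob -setXTT product_measure1E//.
by rewrite [X in (X * _)%E](probability_setT P) [X in (_ * X)%E](probability_setT Q) mule1.
Qed.

HB.instance Definition _ :=
  Measure_isProbability.Build _ _ _ product_prob product_prob_setT.

End product_probability.

Section gaussian.
Context {R : realType}.

Definition cons_col n (w : measurableTypeR R * 'cV[R]_n) : 'cV[R]_n.+1 :=
  col_mx (const_mx (w.1 : R) : 'cV[R]_1) w.2.

Lemma measurable_cons_col n : measurable_fun setT (@cons_col n).
Proof.
apply: measurable_fun_matrix => i j; rewrite /cons_col.
case: (split_ordP (i : 'I_(1 + n))) => k ->.
  have -> : (fun w : measurableTypeR R * 'cV[R]_n =>
      col_mx (const_mx (w.1 : R) : 'cV[R]_1) w.2 (lshift n k) j) = fst.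
    by apply/funext => w; rewrite (@col_mxEu _ 1 n 1) mxE.
  by move=> mT A mA; exact: (measurable_fst mT).
have -> : (fun w : measurableTypeR R * 'cV[R]_n =>
    col_mx (const_mx (w.1 : R) : 'cV[R]_1) w.2 (rshift 1 k) j) =
    (fun v : 'cV[R]_n => v k j) \o snd.
  by apply/funext => w; rewrite (@col_mxEd _ 1 n 1).
by apply: measurableT_comp; [exact: measurable_entry|exact: measurable_snd].
Qed.

HB.instance Definition _ n :=
  isMeasurableFun.Build _ _ _ _ (@cons_col n) (@measurable_cons_col n).

(** The law N(0, I_n) of [n] independent standard normal entries. *)
Fixpoint std_gaussian n : probability 'cV[R]_n R :=
  match n with
  | 0 => \d_(0 : 'cV[R]_0)
  | n'.+1 => distribution
      (product_prob (@normal_prob R 0 1) (std_gaussian n')) (@cons_col n')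
  end.

End gaussian.

Definition log2 {R : realType} (x : R) : R := ln x / ln 2.

Definition log2_plus {R : realType} (x : R) : R := Num.max (log2 x) 0.

Section information.
Context {R : realType}.

(** Relative entropy in bits. The density is positive [P]-a.e., so the value of
    [log2] at 0 does not matter. *)
Definition relative_entropy d (T : measurableType d) (P Q : probability T R)
    : \bar R :=
  if `[< P `<< Q >] then
    (\int[P]_x (log2 (fine
       (Radon_Nikodym (charge_of_finite_measure P) Q x)))%:E)%E
  else +oo%E.

Section mutual_information.
Context d d1 d2 (T : measurableType d) (T1 : measurableType d1)
  (T2 : measurableType d2) (P : probability T R).
Variables (X : {RV P >-> T1}) (Y : {RV P >-> T2}).

Definition pair_RV : T -> T1 * T2 := fun w => (X w, Y w).

Lemma measurable_pair_RV : measurable_fun setT pair_RV.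
Proof. exact: measurable_fun_pair. Qed.

HB.instance Definition _ :=
  isMeasurableFun.Build _ _ _ _ pair_RV measurable_pair_RV.

Definition mutual_information : \bar R :=
  relative_entropy (distribution P pair_RV)
    (product_prob (distribution P X) (distribution P Y)).

End mutual_information.

End information.

(** The norm [`|v|] of the library is the sup norm. *)
Definition enorm {R : realType} n (v : 'cV[R]_n) : R :=
  Num.sqrt (\sum_i v i 0 ^+ 2).

(** [m] is the attained maximum of [S], not just its supremum. *)
Definition is_max {R : realType} (S : set (\bar R)) (m : \bar R) :=
  S m /\ ubound S m.

Section channel.
Context {R : realType} (nt nr : nat).
Implicit Types (H : 'M[R]_(nr, nt)) (X : set 'cV[R]_nt).

(** The input and the noise are the two projections of the probability space
    [product_prob F (std_gaussian nr)], hence independent. *)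
Definition channel_input (w : 'cV[R]_nt * 'cV[R]_nr) : 'cV[R]_nt := w.1.

Definition channel_output H (w : 'cV[R]_nt * 'cV[R]_nr) : 'cV[R]_nr :=
  H *m w.1 + w.2.

Lemma measurable_channel_input : measurable_fun setT channel_input.
Proof. exact: measurable_fst. Qed.

HB.instance Definition _ :=
  isMeasurableFun.Build _ _ _ _ channel_input measurable_channel_input.

Lemma measurable_channel_output H : measurable_fun setT (channel_output H).
Proof.
apply: measurable_fun_matrix => i j; rewrite /channel_output.
have -> : (fun w : 'cV[R]_nt * 'cV[R]_nr => (H *m w.1 + w.2) i j) =
    (fun w => \sum_k H i k * w.1 k j + w.2 i j).
  by apply/funext => w; rewrite !mxE.
apply: measurable_funD; last first.
  exact: (measurableT_comp (measurable_entry i j) measurable_snd).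
apply: measurable_sum => k; apply: measurable_funM => //.
exact: (measurableT_comp (measurable_entry k j) measurable_fst).
Qed.

HB.instance Definition _ H := isMeasurableFun.Build _ _ _ _
  (channel_output H) (measurable_channel_output H).

Definition channel_information H (F : probability 'cV[R]_nt R) : \bar R :=
  @mutual_information R _ _ _ _ _ _ (product_prob F (std_gaussian nr))
    channel_input (channel_output H).

(** A compact [X] is Borel, so [F X = 1] says that [F] is the law of a random
    vector with values in [X]. *)
Definition input_laws X : set (probability 'cV[R]_nt R) :=
  [set F | F X = 1%E].

Definition is_capacity X H : \bar R -> Prop :=
  is_max [set channel_information H F | F in input_laws X].

(** [w.1] and [w.2] are independent copies of the input. *)
Definition overlap H (F : probability 'cV[R]_nt R) : \bar R :=
  ('E_(product_prob F F)
     [fun w => expR (- (enorm (H *m (w.1 - w.2)) ^+ 2 / 4))])%E.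

Definition overlap_bound H (F : probability 'cV[R]_nt R) : R :=
  log2_plus ((2 / expR 1) `^ (nr%:R / 2) * (fine (overlap H F))^-1).

End channel.

(* Main.v *)
(** Write [gamma] for the standard Gaussian law of the noise. By the
    Cameron-Martin formula the pair (input, output) has density
    [g(x, y) = exp (<Hx, y> - |Hx|^2 / 2)] with respect to [F x gamma], and the
    output has density [q(y) = E g(X, y)] with respect to [gamma]. Hence the
    information is [I = E log (g / q)(X, Y)].

    Lower bound: with [r(y) = q(y) exp (- |y|^2 / 2)] one has
    [ln (g / q)(X, HX + Z) = - |Z|^2 / 2 - ln r(Y)]. Jensen's inequality for [ln],
    used in the form [ln t <= t / a - 1 + ln a] with [a = E r(Y)], and the Gaussian
    integral [E r(Y) = 2^(-nr/2) overlap] give the inequality for each input law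
    separately; [I >= 0] is the same argument with [ln t <= t - 1].

    Attainment: a compact set is the image of a subset of [[0, 2]] under
    Schoenberg's space-filling curve, so input laws are laws of the curve composed
    with quantile functions on [[0, 1]]. Helly's selection theorem for these
    monotone functions yields, along a subsequence, almost sure convergence of the
    representing random vectors, and dominated convergence shows that the
    information and the overlap pass to the limit. *)

From HB Require Import structures.
Require Import Defs.
From mathcomp Require Import all_boot all_order all_algebra.
From mathcomp Require Import all_classical all_reals all_analysis.
From mathcomp Require Import measurable_realfun ring lra.

Set Implicit Arguments.
Unset Strict Implicit.
Unset Printing Implicit Defensive.

Import Order.TTheory GRing.Theory Num.Theory.
Import numFieldNormedType.Exports.

Local Open Scope classical_set_scope.
Local Open Scope ring_scope.

(** * Densities and one-dimensional Gaussian integrals *)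

(** Both maxima must be attained, so the input laws need sequential compactness in a form strong
    enough for the information, whose integrand contains the output density and hence the law
    itself. All laws are therefore represented on one fixed probability space, where almost sure
    convergence replaces weak convergence; the curve reduces vectors to the monotone functions that
    Helly's theorem can handle. Compactness of the input set bounds [|Hx|], which squeezes every
    density between two explicit exponentials of [|y|]; hence a quadratic in the noise dominates the
    log-density uniformly over all laws. As the bound decreases with the overlap, its maximum sits
    at a law of least overlap, and the inequality for that one law suffices. *)

Section density.
Context d (T : measurableType d) (R : realType).
Local Open Scope ereal_scope.

Lemma density_dominates (nu mu : {measure set T -> \bar R}) (h : T -> \bar R) :
  measurable_fun setT h ->
  (forall A, measurable A -> nu A = \int[mu]_(x in A) h x) -> nu `<< mu.
Proof.
move=> mh nuE; apply/null_content_dominatesP => A mA muA0.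
by rewrite nuE//; apply: null_set_integral => //; exact: measurable_funTS.
Qed.

(** The density [h] agrees almost everywhere with the Radon-Nikodym derivative, for which the change
    of variables is known. *)
Lemma ge0_integral_density (nu : {finite_measure set T -> \bar R})
    (mu : {sigma_finite_measure set T -> \bar R}) (h f : T -> \bar R) :
  measurable_fun setT h -> (forall x, 0 <= h x) ->
  (forall A, measurable A -> nu A = \int[mu]_(x in A) h x) ->
  measurable_fun setT f -> (forall x, 0 <= f x) ->
  \int[nu]_x f x = \int[mu]_x (f x * h x).
Proof.
move=> mh h0 nuE mf f0.
have nu_mu : nu `<< mu := density_dominates mh nuE.
rewrite -(Radon_Nikodym_SigmaFinite.change_of_variables nu_mu)//.
apply: ae_eq_integral => //.
- apply: emeasurable_funM => //.
  exact: measurable_int (Radon_Nikodym_SigmaFinite.f_integrable nu_mu).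
- exact: emeasurable_funM.
- apply: ae_eqe_mul2l; apply: integral_ae_eq => //.
  + exact: Radon_Nikodym_SigmaFinite.f_integrable.
  + by move=> A _ mA; rewrite -nuE// -Radon_Nikodym_SigmaFinite.f_integral.
Qed.

(** This replaces the abstract derivative in [relative_entropy] by an explicit density. Equality
    holds [nu]-almost everywhere because the logarithm is integrated against [nu]. *)
Lemma ae_eq_Radon_Nikodym (nu : {finite_measure set T -> \bar R})
    (mu : {sigma_finite_measure set T -> \bar R}) (h : T -> \bar R) :
  measurable_fun setT h ->
  (forall A, measurable A -> nu A = \int[mu]_(x in A) h x) ->
  ae_eq nu setT (Radon_Nikodym (charge_of_finite_measure nu) mu) h.
Proof.
move=> mh nuE; have nu_mu : nu `<< mu := density_dominates mh nuE.
apply: (null_dominates_ae_eq measurableT nu_mu); apply: integral_ae_eq => //.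
- exact: Radon_Nikodym_integrable.
- by move=> A _ mA; rewrite -nuE// -Radon_Nikodym_integral.
Qed.

End density.

Section gaussian_integrals.
Context {R : realType}.
Notation N01 := (@normal_prob R 0 1).
Local Open Scope ereal_scope.

(** Lebesgue measure is determined by its values on intervals, and translations preserve their
    lengths. *)
Lemma ge0_integral_shift (a : R) (f : measurableTypeR R -> \bar R) :
  measurable_fun setT f -> (forall x, 0 <= f x) ->
  \int[lebesgue_measure]_x f (a + x)%R = \int[lebesgue_measure]_x f x.
Proof.
move=> mf f0.
pose phi : measurableTypeR R -> measurableTypeR R := fun x => (a + x)%R.
have mphi : measurable_fun setT phi by exact: measurable_funD.
pose mixin := isMeasurableFun.Build _ _ _ _ phi mphi.
pose p : {mfun measurableTypeR R >-> measurableTypeR R} := HB.pack phi mixin.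
have <- : \int[pushforward lebesgue_measure p]_x f x =
  \int[lebesgue_measure]_x f (a + x)%R by rewrite ge0_integral_pushforward.
apply: eq_measure_integral => A mA _.
apply/esym/lebesgue_measure_unique => //= _ [[u v]] _ <-.
rewrite /pushforward/=.
have -> : p @^-1` `]u, v]%classic = `]u - a, v - a]%classic%R.
  by apply/seteqP; split => x /=; rewrite !in_itv/= /phi ltrBlDl lerBrDl.
by rewrite !lebesgue_measure_itv/= !lte_fin ltrD2r -!EFinB opprB addrA subrK.
Qed.

Lemma ge0_integral_normal_prob (m s : R) (f : measurableTypeR R -> \bar R) :
  measurable_fun setT f -> (forall x, 0 <= f x) ->
  \int[normal_prob m s]_x f x =
  \int[lebesgue_measure]_x (f x * (normal_pdf m s x)%:E).
Proof.
move=> mf f0; apply: (@ge0_integral_density _ (measurableTypeR R) R _ _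
  (fun x => (normal_pdf m s x)%:E)) => //.
- by apply/measurable_EFinP; exact: measurable_normal_pdf.
- by move=> x; rewrite lee_fin normal_pdf_ge0.
Qed.

(** Substitute [y = a + z] and expand: [- (y - a)^2 / 2 = - y^2 / 2 + (a y - a^2 / 2)]. *)
Lemma normal_cameron_martin (a : R) (f : measurableTypeR R -> \bar R) :
  measurable_fun setT f -> (forall x, 0 <= f x) ->
  \int[N01]_z f (a + z)%R =
  \int[N01]_y (f y * (expR (a * y - a ^+ 2 / 2))%:E).
Proof.
move=> mf f0; rewrite ge0_integral_normal_prob//; last first.
  by apply: measurableT_comp => //; exact: measurable_funD.
rewrite ge0_integral_normal_prob//; last 2 first.
- apply: emeasurable_funM => //; apply/measurable_EFinP.
  apply: measurableT_comp => //; apply: measurable_funB => //;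
  exact: measurable_funM.
- by move=> x; rewrite mule_ge0// lee_fin expR_ge0.
rewrite -[RHS](ge0_integral_shift a); last 2 first.
- apply: emeasurable_funM; last by apply/measurable_EFinP; exact: measurable_normal_pdf.
  apply: emeasurable_funM => //; apply/measurable_EFinP.
  apply: measurableT_comp => //; apply: measurable_funB => //;
  exact: measurable_funM.
- by move=> x; rewrite !mule_ge0// lee_fin ?expR_ge0// normal_pdf_ge0.
apply: eq_integral => x _; rewrite -muleA; congr (_ * _).
rewrite -EFinM; congr EFin; rewrite !normal_pdfE ?oner_neq0// mulrCA; congr (_ * _)%R.
rewrite /normal_fun -expRD; congr expR; by field.
Qed.

(** With the weight of the law the exponent is [c y - y^2 = c^2 / 4 - (y - c / 2)^2]: up to a
    constant, a normal density of mean [c / 2] and standard deviation [1 / sqrt 2]. *)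
Lemma integral_normal_gauss (c : R) :
  \int[N01]_y (expR (c * y - y ^+ 2 / 2))%:E =
  ((Num.sqrt 2)^-1 * expR (c ^+ 2 / 4))%:E.
Proof.
have s2 : (Num.sqrt 2 : R) != 0%R by rewrite sqrtr_eq0 -ltNge ltr0n.
rewrite ge0_integral_normal_prob//; last first.
  apply/measurable_EFinP; apply: measurableT_comp => //.
  by apply: measurable_funB => //; apply: measurable_funM => //;
    exact: measurable_funX.
transitivity (\int[lebesgue_measure]_x
   (((Num.sqrt 2)^-1 * expR (c ^+ 2 / 4))%:E *
     (normal_pdf (c / 2) (Num.sqrt 2)^-1 x)%:E)).
  apply: eq_integral => x _; rewrite -!EFinM; congr EFin.
  have p1 : (normal_peak 1 = (Num.sqrt 2)^-1 * (Num.sqrt pi)^-1 :> R)%R.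
    by rewrite /normal_peak expr1n mul1r -mulr_natl sqrtrM ?ler0n// invfM.
  have p2 : (normal_peak (Num.sqrt 2)^-1 = (Num.sqrt pi)^-1 :> R)%R.
    rewrite /normal_peak exprVn sqr_sqrtr ?ler0n// -mulr_natl mulrA mulfV ?mul1r//.
  rewrite !normal_pdfE ?oner_neq0 ?invr_eq0// p1 p2 /normal_fun.
  rewrite exprVn sqr_sqrtr ?ler0n// expr1n mulrCA -expRD mulrACA -expRD.
  by congr (_ * expR _)%R; field.
rewrite ge0_integralZl//=.
- by rewrite integral_normal_pdf mule1.
- by apply/measurable_EFinP; exact: measurable_normal_pdf.
- by move=> x _; rewrite lee_fin normal_pdf_ge0.
Qed.

End gaussian_integrals.

(** * The standard Gaussian law on column vectors *)

Lemma expR_ge_quadratic {R : realType} (u : R) : 0 <= u ->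
  1 + u + u ^+ 2 / 2 <= expR u.
Proof.
move=> u0.
have nd : nondecreasing_seq (series (exp_coeff u)).
  by apply/nondecreasing_seqP => n; rewrite seriesSr lerDl divr_ge0// exprn_ge0.
have := nondecreasing_cvgn_le nd (is_cvg_series_exp_coeff u) 3.
apply: le_trans; rewrite /series/= !big_nat_recr//= big_geq// /exp_coeff/=.
by rewrite expr0 divr1 expr1 divr1 add0r.
Qed.

(* With [w = 1 + u + u^2/2 <= e^u], [e^u - e^-u >= w - 1/w >= 2u]; apply it at
   [u = x/2] and square. *)
Lemma expR_expRN_ge {R : realType} (x : R) : 2 + x ^+ 2 <= expR x + expR (- x).
Proof.
wlog x0 : x / 0 <= x.
  move=> h; have [/h//|/ltW xle0] := leP 0 x.
  by move: (h (- x)); rewrite opprK sqrrN oppr_ge0 [expR (- x) + _]addrC; apply.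
pose u := x / 2; have u0 : 0 <= u by rewrite divr_ge0.
have wE := expR_ge_quadratic u0; set w := (1 + u + _) in wE.
have w0 : 0 < w by rewrite /w; nra.
have e0 := expR_gt0 u.
have wV : expR (- u) <= w^-1 by rewrite expRN lef_pV2 ?posrE.
have h1 : 2 * u <= w - w^-1.
  rewrite -(ler_pM2r w0) mulrBl mulVf ?gt_eqF//.
  rewrite /w; nra.
have h2 : 2 * u <= expR u - expR (- u) by lra.
have h3 : expR u * expR (- u) = 1 by rewrite expRxMexpNx_1.
have -> : x = u + u by rewrite /u; field.
rewrite opprD !expRD; nra.
Qed.

Section std_gaussian.
Context {R : realType}.
Notation N01 := (@normal_prob R 0 1).

(** Density at [y] of the translate by [a] of the standard Gaussian law,
    relative to that law. *)
Definition gaussian_shift n (a y : 'cV[R]_n) : R :=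
  expR (\sum_i (a i 0 * y i 0 - a i 0 ^+ 2 / 2)).

Lemma measurable_gaussian_shift d (U : measurableType d) n (f g : U -> 'cV[R]_n) :
  measurable_fun setT f -> measurable_fun setT g ->
  measurable_fun setT (fun u => gaussian_shift (f u) (g u)).
Proof.
move=> mf mg; apply: measurableT_comp => //; apply: measurable_sum => i.
have mentry (h : U -> 'cV[R]_n) : measurable_fun setT h ->
    measurable_fun setT (fun u => h u i 0).
  by move=> mh; exact: (measurableT_comp (measurable_entry i 0) mh).
apply: measurable_funB; first by apply: measurable_funM; exact: mentry.
by apply: measurable_funM => //; apply: measurable_funX; exact: mentry.
Qed.

Lemma gaussian_shift_gt0 n (a y : 'cV[R]_n) : 0 < gaussian_shift a y.
Proof. exact: expR_gt0. Qed.

Lemma gaussian_shift_ge0 n (a y : 'cV[R]_n) : 0 <= gaussian_shift a y.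
Proof. exact: expR_ge0. Qed.

Local Open Scope ereal_scope.

Lemma ge0_integral_std_gaussianS n (f : 'cV[R]_n.+1 -> \bar R) :
  measurable_fun setT f -> (forall y, 0 <= f y) ->
  \int[std_gaussian n.+1]_y f y =
  \int[N01]_t \int[std_gaussian n]_v f (cons_col (t, v)).
Proof.
move=> mf f0; rewrite [LHS]ge0_integral_distribution//.
rewrite [LHS]fubini_tonelli1//; last by move=> w; exact: f0.
by apply: measurableT_comp => //; exact: measurable_cons_col.
Qed.

Lemma cons_col0 n (t : R) (v : 'cV[R]_n) : cons_col (t, v) ord0 0%R = t.
Proof.
rewrite /cons_col; have -> : (ord0 : 'I_n.+1) = lshift n (ord0 : 'I_1) by apply/val_inj.
by rewrite (@col_mxEu _ 1 n 1) mxE.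
Qed.

Lemma cons_colS n (t : R) (v : 'cV[R]_n) i : cons_col (t, v) (lift ord0 i) 0%R = v i 0%R.
Proof.
rewrite /cons_col; have -> : lift ord0 i = rshift 1 i by apply/val_inj.
by rewrite (@col_mxEd _ 1 n 1).
Qed.

Lemma measurable_cons_col_l n (t : R) :
  measurable_fun setT (fun v : 'cV[R]_n => cons_col (t, v)).
Proof. exact: (measurableT_comp (@measurable_cons_col R n) (pair1_measurable _)). Qed.

(** Induction on the dimension: the induction hypothesis acts at fixed first coordinate, then the
    one-dimensional formula is applied to the inner integral [g]. *)
Lemma std_gaussian_cameron_martin n (a : 'cV[R]_n) (f : 'cV[R]_n -> \bar R) :
  measurable_fun setT f -> (forall y, 0 <= f y) ->
  \int[std_gaussian n]_z f (a + z)%R =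
  \int[std_gaussian n]_y (f y * (gaussian_shift a y)%:E).
Proof.
elim: n => [|n IHn] in a f * => mf f0.
  apply: eq_integral => y _.
  rewrite /gaussian_shift big_ord0 expR0 mule1.
  by congr f; rewrite [LHS]flatmx0 [RHS]flatmx0.
pose a0 := a ord0 0%R; pose a' : 'cV[R]_n := (\col_i a (lift ord0 i) 0)%R.
have acons t v : (a + cons_col (t, v) = cons_col (a0 + t, a' + v))%R.
  apply/matrixP => i j; rewrite (ord1 j) mxE.
  case: (unliftP ord0 i) => [k|] ->; last by rewrite !cons_col0.
  by rewrite !cons_colS !mxE.
have gcons t v : (gaussian_shift a (cons_col (t, v)) =
    gaussian_shift a' v * expR (a0 * t - a0 ^+ 2 / 2))%R.
  rewrite /gaussian_shift big_ord_recl expRD mulrC cons_col0; congr (expR _ * _)%R.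
  by apply: eq_bigr => i _; rewrite cons_colS mxE.
have mg : measurable_fun setT (fun y => f y * (gaussian_shift a y)%:E).
  by apply: emeasurable_funM => //; apply/measurable_EFinP; exact: measurable_gaussian_shift.
pose g (s : measurableTypeR R) :=
  \int[std_gaussian n]_v (f (cons_col (s, v)) * (gaussian_shift a' v)%:E).
have mfcons : measurable_fun setT (fun w : measurableTypeR R * 'cV[R]_n =>
    f (cons_col w) * (gaussian_shift a' w.2)%:E).
  apply: emeasurable_funM.
    by apply: measurableT_comp => //; exact: measurable_cons_col.
  apply/measurable_EFinP; apply: measurableT_comp => //.
  exact: measurable_gaussian_shift.
rewrite ge0_integral_std_gaussianS//; last first.
  apply: measurableT_comp => //; apply: measurable_fun_matrix => i j.
  under eq_fun do rewrite mxE; apply: measurable_funD => //; exact: measurable_entry.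
transitivity (\int[N01]_t g (a0 + t)%R).
  apply: eq_integral => t _; rewrite /g -IHn//.
    by apply: eq_integral => v _; rewrite acons.
  by apply: measurableT_comp => //; exact: measurable_cons_col_l.
rewrite normal_cameron_martin//; last 2 first.
- apply: (measurable_fun_fubini_tonelli_F _ mfcons) => w.
  by rewrite mule_ge0// lee_fin expR_ge0.
- by move=> s; apply: integral_ge0 => v _; rewrite mule_ge0// lee_fin expR_ge0.
rewrite ge0_integral_std_gaussianS//; last first.
  by move=> y; rewrite mule_ge0// lee_fin expR_ge0.
apply: eq_integral => t _; rewrite -ge0_integralZr//.
- by apply: eq_integral => v _; rewrite -muleA -EFinM gcons.
- exact: (measurableT_comp mfcons (pair1_measurable _)).
- by move=> v _; rewrite mule_ge0// lee_fin expR_ge0.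
Qed.

Lemma integral_std_gaussian_prod n (f : 'I_n -> R -> R) :
  (forall i, measurable_fun setT (f i)) -> (forall i t, (0 <= f i t)%R) ->
  \int[std_gaussian n]_y (\prod_i f i (y i 0))%R%:E =
  \prod_i \int[N01]_t (f i t)%:E.
Proof.
elim: n => [|n IHn] in f * => mf f0.
  rewrite big_ord0; under eq_integral do rewrite big_ord0.
  by rewrite integral_cst// [X in (_ * X)%E]probability_setT mule1.
have mprod m (h : 'I_m -> R -> R) : (forall i, measurable_fun setT (h i)) ->
    measurable_fun setT (fun y : 'cV[R]_m => (\prod_i h i (y i 0))%R%:E).
  move=> mh; apply/measurable_EFinP; apply: measurable_prod => i _.
  by apply: measurableT_comp => //; exact: measurable_entry.
rewrite ge0_integral_std_gaussianS//; last 2 first.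
- exact: mprod.
- by move=> y; rewrite lee_fin prodr_ge0.
rewrite big_ord_recl -IHn//.
transitivity (\int[N01]_t ((f ord0 t)%:E *
    \int[std_gaussian n]_y (\prod_i f (lift ord0 i) (y i 0))%R%:E)).
  apply: eq_integral => t _; rewrite -ge0_integralZl//.
  - apply: eq_integral => v _; rewrite big_ord_recl cons_col0 -EFinM; congr (_ * _)%R%:E.
    by apply: eq_bigr => i _; rewrite cons_colS.
  - by apply: (mprod _ (fun i => f (lift ord0 i))) => i; exact: mf.
  - by move=> v _; rewrite lee_fin prodr_ge0.
  - by rewrite lee_fin.
rewrite ge0_integralZr//.
- by apply/measurable_EFinP; exact: mf.
- by move=> t _; rewrite lee_fin.
- by apply: integral_ge0 => v _; rewrite lee_fin prodr_ge0.
Qed.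

End std_gaussian.

Section std_gaussian_moments.
Context {R : realType}.
Notation N01 := (@normal_prob R 0 1).
Local Open Scope ereal_scope.

(** In each coordinate [integral_normal_gauss] at [c = a + b] leaves the exponent [(a + b)^2 / 4 -
    a^2 / 2 - b^2 / 2 = - (a - b)^2 / 4]; this is the origin of the overlap kernel. *)
Lemma integral_std_gaussian_gauss n (a b : 'cV[R]_n) :
  \int[std_gaussian n]_y
    (gaussian_shift a y * gaussian_shift b y * expR (- (\sum_i y i 0 ^+ 2 / 2)))%R%:E =
  ((Num.sqrt 2)^-1 ^+ n * expR (- (\sum_i (a i 0 - b i 0) ^+ 2 / 4)))%R%:E.
Proof.
pose k i : R := (- (a i 0%R ^+ 2 / 2) - (b i 0%R ^+ 2 / 2))%R.
pose f i (t : R) : R := (expR (k i) * expR ((a i 0%R + b i 0%R) * t - t ^+ 2 / 2))%R.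
have mf i : measurable_fun setT (f i).
  apply: measurable_funM => //; apply: measurableT_comp => //.
  by apply: measurable_funB => //; apply: measurable_funM => //; exact: measurable_funX.
have f0 i t : (0 <= f i t)%R by rewrite mulr_ge0 ?expR_ge0.
transitivity (\int[std_gaussian n]_y (\prod_i f i (y i 0))%R%:E).
  apply: eq_integral => y _; congr EFin.
  rewrite /gaussian_shift -!expRD -sumrN -!big_split/= expR_sum.
  by apply: eq_bigr => i _; rewrite /f /k -expRD; congr expR; ring.
rewrite integral_std_gaussian_prod//.
transitivity (\prod_i ((Num.sqrt 2)^-1 * expR (- ((a i 0 - b i 0) ^+ 2 / 4)))%R%:E)%E.
  apply: eq_bigr => i _; rewrite /f.
  under eq_integral do rewrite EFinM.
  rewrite ge0_integralZl//; last first.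
    apply/measurable_EFinP; apply: measurableT_comp => //.
    by apply: measurable_funB => //; apply: measurable_funM => //; exact: measurable_funX.
  rewrite integral_normal_gauss -EFinM; congr EFin.
  by rewrite mulrCA -expRD; congr (_ * expR _)%R; rewrite /k; field.
rewrite -(big_morph EFin (@EFinM R) erefl); congr EFin; rewrite big_split/= prodr_const card_ord.
by rewrite -expR_sum sumrN.
Qed.

Lemma integral_normal_expR (a : R) :
  \int[N01]_t (expR (a * t))%:E = (expR (a ^+ 2 / 2))%:E.
Proof.
have := @normal_cameron_martin R a (cst 1) (measurable_cst _) (fun=> lee01).
rewrite integral_cst// [X in _ * X]probability_setT mule1 => e.
rewrite -[RHS]mule1 e -ge0_integralZl//.
- by apply: eq_integral => t _; rewrite mul1e -EFinM -expRD; congr (expR _)%:E; ring.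
- apply: emeasurable_funM => //; apply/measurable_EFinP; apply: measurableT_comp => //.
  exact: measurable_funB.
- by move=> t _; rewrite mul1e lee_fin expR_ge0.
Qed.

(** Integrating [2 + (h t)^2 <= exp (h t) + exp (- h t)] bounds the second moment [v] by
    [2 + h^2 v <= 2 exp (h^2 / 2)]; letting [h] tend to 0 gives the claim. *)
Lemma integral_normal_sqr_le1 : \int[N01]_t (t ^+ 2)%:E <= 1.
Proof.
have m2 : measurable_fun setT (fun t : measurableTypeR R => (t ^+ 2)%:E).
  by apply/measurable_EFinP; exact: measurable_funX.
have mexp (a : R) : measurable_fun setT (fun t : measurableTypeR R => (expR (a * t))%:E).
  by apply/measurable_EFinP; exact: measurableT_comp.
have key (h : R) : 2%:E + (h ^+ 2)%:E * \int[N01]_t (t ^+ 2)%:E <=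
    (2 * expR (h ^+ 2 / 2))%:E.
  have -> : 2%:E + (h ^+ 2)%:E * \int[N01]_t (t ^+ 2)%:E =
      \int[N01]_t (2%:E + (h ^+ 2)%:E * (t ^+ 2)%:E).
    rewrite ge0_integralD//; last 2 first.
    - by move=> t _; rewrite -EFinM lee_fin mulr_ge0 ?sqr_ge0.
    - exact: measurable_funeM.
    rewrite integral_cst// [X in _ * X + _]probability_setT mule1 ge0_integralZl//.
    + by move=> t _; rewrite lee_fin sqr_ge0.
    + by rewrite lee_fin sqr_ge0.
  have -> : (2 * expR (h ^+ 2 / 2))%:E =
      \int[N01]_t ((expR (h * t))%:E + (expR (- h * t))%:E).
    rewrite ge0_integralD//; [|by move=> t _; rewrite lee_fin expR_ge0..].
    by rewrite !integral_normal_expR sqrrN -EFinD -mulr2n mulr_natl.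
  apply: ge0_le_integral => //.
  - by move=> t _; rewrite -EFinM -EFinD lee_fin addr_ge0// mulr_ge0 ?sqr_ge0.
  - by apply: emeasurable_funD => //; exact: measurable_funeM.
  - exact: emeasurable_funD.
  - move=> t _; rewrite -EFinM -!EFinD lee_fin mulNr -exprMn.
    exact: expR_expRN_ge.
(* The instance [h = 1] excludes an infinite moment. *)
have := key 1%R.
have I0 : 0 <= \int[N01]_t (t ^+ 2)%:E.
  by apply: integral_ge0 => t _; rewrite lee_fin sqr_ge0.
move: (\int[N01]_t (t ^+ 2)%:E) I0 key => [v| |]//; last first.
  by move=> _ _; rewrite expr1n mul1e.
rewrite !lee_fin => v0 key _; rewrite leNgt; apply/negP => v1.
(* With [h^2 = 2 s] the bound reads [1 + s v <= exp s <= 1 / (1 - s)]. *)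
have key2 (s : R) : (0 < s -> s < 1 -> v * (1 - s) <= 1)%R.
  move=> s0 s1; have := key (Num.sqrt (2 * s)).
  have s20 : (0 <= 2 * s)%R by rewrite mulr_ge0// ltW.
  rewrite sqr_sqrtr// -EFinM -EFinD lee_fin (_ : 2 * s / 2 = s)%R; last by field.
  move=> {}key; have e1 := expR_ge1Dx (- s); have e2 := expRxMexpNx_1 s.
  have e3 : (expR s * (1 - s) <= 1)%R by rewrite -[leRHS]e2 ler_pM2l ?expR_gt0.
  have e4 : ((1 + s * v) * (1 - s) <= 1)%R.
    by apply: le_trans e3; rewrite ler_pM2r; lra.
  rewrite -(ler_pM2l s0); lra.
(* For [v > 1] this [s] gives [v (1 - s) = (v + 1) / 2 > 1], a contradiction. *)
have w := key2 ((v - 1) / (2 * v))%R.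
have vp : (0 < v)%R by lra.
have : (v * (1 - (v - 1) / (2 * v)) <= 1)%R.
  by apply: w; [rewrite divr_gt0//; lra|rewrite ltr_pdivrMr; lra].
have -> : (v * (1 - (v - 1) / (2 * v)) = (v + 1) / 2)%R.
  by field; rewrite gt_eqF.
lra.
Qed.

Lemma integral_std_gaussian_sqr_le1 n (i : 'I_n) :
  \int[@std_gaussian R n]_y (y i 0 ^+ 2)%R%:E <= 1.
Proof.
pose f j (t : R) : R := if j == i then (t ^+ 2)%R else 1%R.
have -> : \int[@std_gaussian R n]_y ((y i 0 : R) ^+ 2)%R%:E =
    \int[@std_gaussian R n]_y (\prod_j f j (y j 0))%R%:E.
  apply: eq_integral => y _; congr EFin.
  rewrite (bigD1 i)//= /f eqxx big1 ?mulr1// => j /negbTE ->//.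
rewrite integral_std_gaussian_prod.
- rewrite (bigD1 i)//= /f eqxx big1 ?mule1 ?integral_normal_sqr_le1// => j /negbTE ->.
  by rewrite integral_cst// mul1e; exact: probability_setT.
- by move=> j; rewrite /f; case: (j == i) => //; exact: measurable_funX.
- by move=> j t; rewrite /f; case: ifP => // _; exact: sqr_ge0.
Qed.

End std_gaussian_moments.

(** * Information of a channel law *)

Section channel_density.
Context {R : realType} (nt nr : nat) (H : 'M[R]_(nr, nt)).
Variable F : probability 'cV[R]_nt R.
Local Notation gamma := (@std_gaussian R nr).

Definition output_density (y : 'cV[R]_nr) : R :=
  fine (\int[F]_x (gaussian_shift (H *m x) y)%:E)%E.

Lemma measurable_mulmx : measurable_fun setT (fun x : 'cV[R]_nt => H *m x).
Proof.
apply: measurable_fun_matrix => i j.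
have -> : (fun x : 'cV[R]_nt => (H *m x) i j) = (fun x => \sum_k H i k * x k j).
  by apply/funext => x; rewrite mxE.
apply: measurable_sum => k; apply: measurable_funM => //; exact: measurable_entry.
Qed.

Lemma measurable_shift_density :
  measurable_fun setT (fun w : 'cV[R]_nt * 'cV[R]_nr => gaussian_shift (H *m w.1) w.2).
Proof.
apply: measurable_gaussian_shift; last exact: measurable_snd.
exact: (measurableT_comp measurable_mulmx measurable_fst).
Qed.

Let measurable_shift_densityE :
  measurable_fun setT (fun w : 'cV[R]_nt * 'cV[R]_nr =>
    (gaussian_shift (H *m w.1) w.2)%:E).
Proof. by apply/measurable_EFinP; exact: measurable_shift_density. Qed.

Local Open Scope ereal_scope.

Lemma measurable_output_densityE :
  measurable_fun setT (fun y => \int[F]_x (gaussian_shift (H *m x) y)%:E).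
Proof.
apply: (@measurable_fun_fubini_tonelli_G _ _ _ _ _ F
  (fun w => (gaussian_shift (H *m w.1) w.2)%:E)); first exact: measurable_shift_densityE.
by move=> w; rewrite lee_fin gaussian_shift_ge0.
Qed.

Lemma measurable_output_density : measurable_fun setT output_density.
Proof. exact: (measurableT_comp (fine_measurable measurableT) measurable_output_densityE). Qed.

(** Since [a y - a^2 / 2 <= y^2 / 2] for every [a], the integrand is bounded uniformly in [x],
    whatever the law. *)
Lemma output_density_fin_num y :
  \int[F]_x (gaussian_shift (H *m x) y)%:E \is a fin_num.
Proof.
rewrite ge0_fin_numE; last by apply: integral_ge0 => x _; rewrite lee_fin gaussian_shift_ge0.
apply: (@le_lt_trans _ _ (\int[F]_x (cst (expR (\sum_i y i 0 ^+ 2 / 2))%:E x))).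
  apply: ge0_le_integral => //.
  - by move=> x _; rewrite lee_fin gaussian_shift_ge0.
  - exact: (measurableT_comp measurable_shift_densityE (pair2_measurable _)).
  - move=> x _; rewrite lee_fin ler_expR; apply: ler_sum => i _.
    rewrite -subr_ge0 (_ : (_ - _)%R = (((H *m x) i 0 - y i 0) ^+ 2 / 2)%R); last by field.
    by rewrite divr_ge0// sqr_ge0.
by rewrite integral_cst// [X in _ * X]probability_setT mule1 ltry.
Qed.

Lemma output_densityE y :
  (output_density y)%:E = \int[F]_x (gaussian_shift (H *m x) y)%:E.
Proof. by rewrite fineK// output_density_fin_num. Qed.

Lemma ge0_integral_channel_joint (k : 'cV[R]_nt * 'cV[R]_nr -> \bar R) :
  measurable_fun setT k -> (forall w, 0 <= k w) ->
  \int[product_prob F gamma]_w k (w.1, channel_output H w) =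
  \int[F]_x \int[gamma]_y (k (x, y) * (gaussian_shift (H *m x) y)%:E).
Proof.
move=> mk k0.
have mpair : measurable_fun setT (fun w : 'cV[R]_nt * 'cV[R]_nr => (w.1, channel_output H w)).
  by apply: measurable_fun_pair; [exact: measurable_fst|exact: measurable_channel_output].
rewrite [LHS]fubini_tonelli1//; last exact: measurableT_comp.
apply: eq_integral => x _; rewrite -std_gaussian_cameron_martin//.
exact: (measurableT_comp mk (pair1_measurable x)).
Qed.

Lemma ge0_integral_channel_output (k : 'cV[R]_nr -> \bar R) :
  measurable_fun setT k -> (forall y, 0 <= k y) ->
  \int[product_prob F gamma]_w k (channel_output H w) =
  \int[gamma]_y (k y * (output_density y)%:E).
Proof.
move=> mk k0.
rewrite (ge0_integral_channel_joint (k := k \o snd))//=; last first.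
  exact: (measurableT_comp mk measurable_snd).
rewrite (@fubini_tonelli _ _ _ _ _ F gamma
  (fun w => k w.2 * (gaussian_shift (H *m w.1) w.2)%:E))/=; last 2 first.
- apply: emeasurable_funM => //; exact: (measurableT_comp mk measurable_snd).
- by move=> w; rewrite mule_ge0// lee_fin gaussian_shift_ge0.
apply: eq_integral => y _; rewrite output_densityE ge0_integralZl//.
- exact: (measurableT_comp measurable_shift_densityE (pair2_measurable _)).
- by move=> x _; rewrite lee_fin gaussian_shift_ge0.
Qed.

Lemma ge0_integral_channel_input (k : 'cV[R]_nt -> \bar R) :
  measurable_fun setT k -> (forall x, 0 <= k x) ->
  \int[product_prob F gamma]_w k w.1 = \int[F]_x k x.
Proof.
move=> mk k0.
rewrite [LHS]fubini_tonelli1//; last exact: (measurableT_comp mk measurable_fst).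
apply: eq_integral => x _; rewrite /fubini_F/= integral_cst//.
by rewrite [X in _ * X]probability_setT mule1.
Qed.

End channel_density.

Section product_prob_lemmas.
Context d1 d2 (T1 : measurableType d1) (T2 : measurableType d2) (R : realType).
Variables (P : probability T1 R) (Q : probability T2 R).

Lemma ae_product_fst (A : T1 -> Prop) : {ae P, forall x, A x} ->
  {ae product_prob P Q, forall w, A w.1}.
Proof.
move=> [N [mN N0 sN]]; exists (N `*` setT); split.
- exact: measurableX.
- by rewrite /product_prob/= product_measure1E// [X in (X * _)%E]N0 mul0e.
- by move=> w /= /sN.
Qed.

Lemma ae_product_snd (A : T2 -> Prop) : {ae Q, forall x, A x} ->
  {ae product_prob P Q, forall w, A w.2}.
Proof.
move=> [N [mN N0 sN]]; exists (setT `*` N); split.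
- exact: measurableX.
- by rewrite /product_prob/= product_measure1E// [X in (_ * X)%E]N0 mule0.
- by move=> w /= /sN.
Qed.

Lemma integrable_product_snd (f : T2 -> \bar R) : Q.-integrable setT f ->
  (product_prob P Q).-integrable setT (fun w => f w.2).
Proof.
move=> /integrableP[mf foo]; apply/integrable12ltyP.
  exact: (measurableT_comp mf measurable_snd).
by rewrite /= integral_cst// [X in (_ * X)%E]probability_setT mule1.
Qed.

End product_prob_lemmas.

Section bounded_input.
Context {R : realType} (nt nr : nat) (H : 'M[R]_(nr, nt)) (M : R).
Hypothesis M0 : 0 <= M.
Local Notation gamma := (@std_gaussian R nr).

(** The estimates see the input only through [Hx]; a compact input set is contained in such a set
    for a suitable [M]. *)
Definition bounded_image : set 'cV[R]_nt := [set x | forall i, `|(H *m x) i 0| <= M].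

Lemma measurable_bounded_image : measurable bounded_image.
Proof.
have -> : bounded_image = \bigcap_(i in [set: 'I_nr]) [set x | `|(H *m x) i 0| <= M].
  by apply/seteqP; split => x /= h i; [move=> _|]; exact: h.
apply: fin_bigcap_measurable => // i _.
have m : measurable_fun setT (fun x : 'cV[R]_nt => `|(H *m x) i 0|).
  apply: measurableT_comp => //.
  exact: (measurableT_comp (measurable_entry i 0) (measurable_mulmx H)).
rewrite -[X in measurable X]setTI.
have := m measurableT _ (measurable_itv `]-oo, M]).
by congr measurable; apply/seteqP; split => x /=; rewrite in_itv.
Qed.

(* [|a y - a^2 / 2| <= M |y| + M^2 / 2] when [|a| <= M]. *)
Definition shift_exponent (y : 'cV[R]_nr) : R := \sum_i (M * `|y i 0| + M ^+ 2 / 2).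

Lemma gaussian_shift_bounds (a y : 'cV[R]_nr) : (forall i, `|a i 0| <= M) ->
  expR (- shift_exponent y) <= gaussian_shift a y <= expR (shift_exponent y).
Proof.
move=> aM; rewrite !ler_expR -ler_norml; apply: le_trans (ler_norm_sum _ _ _) _.
apply: ler_sum => i _; apply: le_trans (ler_normB _ _) _.
apply: lerD; first by rewrite normrM ler_wpM2r.
rewrite normrM normrX (ger0_norm (x := 2^-1)) ?invr_ge0//.
by rewrite ler_wpM2r ?invr_ge0// lerXn2r ?nnegrE.
Qed.

Section fixed_law.
Variable F : probability 'cV[R]_nt R.
Hypothesis FM : F bounded_image = 1%E.

Lemma bounded_image_ae : {ae F, forall x, bounded_image x}.
Proof.
exists (~` bounded_image); split => //.
  by apply: measurableC; exact: measurable_bounded_image.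
by rewrite [LHS]probability_setC ?FM ?subee//; exact: measurable_bounded_image.
Qed.

Lemma output_density_bounds (y : 'cV[R]_nr) :
  expR (- shift_exponent y) <= output_density H F y <= expR (shift_exponent y).
Proof.
have mg : measurable_fun setT (fun x : 'cV[R]_nt => (gaussian_shift (H *m x) y)%:E).
  by apply/measurable_EFinP; apply: measurable_gaussian_shift => //; exact: measurable_mulmx.
have cstE c : (\int[F]_x (cst c%:E x) = c%:E)%E.
  by rewrite integral_cst// [X in (_ * X)%E]probability_setT mule1.
rewrite -!lee_fin output_densityE -(cstE (expR (- _))) -(cstE (expR (shift_exponent y))).
apply/andP; split; apply: ae_ge0_le_integral => //.
- by move=> x _; rewrite lee_fin expR_ge0.
- by move=> x _; rewrite lee_fin gaussian_shift_ge0.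
- apply: filterS bounded_image_ae => x /gaussian_shift_bounds-/(_ y)/andP[+ _] _.
  by rewrite lee_fin.
- by move=> x _; rewrite lee_fin gaussian_shift_ge0.
- by move=> x _; rewrite lee_fin expR_ge0.
- apply: filterS bounded_image_ae => x /gaussian_shift_bounds-/(_ y)/andP[_ +] _.
  by rewrite lee_fin.
Qed.

Lemma output_density_gt0 y : 0 < output_density H F y.
Proof. by case/andP: (output_density_bounds y) => + _; apply: lt_le_trans; rewrite expR_gt0. Qed.

End fixed_law.

Definition info_density (F : probability 'cV[R]_nt R) (w : 'cV[R]_nt * 'cV[R]_nr) : R :=
  ln (gaussian_shift (H *m w.1) w.2) - ln (output_density H F w.2).

(* Bounds twice [shift_exponent] at [Hx + z], by [|z| <= 1 + z^2]. *)
Definition info_bound (z : 'cV[R]_nr) : R :=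
  \sum_i (2 * M * z i 0 ^+ 2 + (2 * M * (M + 1) + M ^+ 2)).

(** The bound depends on the noise alone and not on [F], so it can dominate a whole sequence of
    laws. *)
Lemma info_density_le (F : probability 'cV[R]_nt R) x z : F bounded_image = 1%E ->
  bounded_image x -> `|info_density F (x, channel_output H (x, z))| <= info_bound z.
Proof.
move=> FM Mx; rewrite /info_density/=; set y := channel_output H (x, z).
have /andP[g1 g2] := gaussian_shift_bounds y Mx.
have /andP[q1 q2] := output_density_bounds FM y.
have g0 := gaussian_shift_gt0 (H *m x) y; have q0 := output_density_gt0 FM y.
have lnE t : expR (- shift_exponent y) <= t <= expR (shift_exponent y) ->
    `|ln t| <= shift_exponent y.
  move=> /andP[t1 t2]; have t0 : 0 < t by apply: lt_le_trans t1; rewrite expR_gt0.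
  by rewrite ler_norml -{1}[- _]expRK -{2}[shift_exponent y]expRK !ler_ln ?posrE ?expR_gt0// t1.
apply: le_trans (ler_normB _ _) _.
apply: (@le_trans _ _ (shift_exponent y + shift_exponent y)).
  by apply: lerD; apply: lnE; apply/andP.
rewrite /shift_exponent -big_split/=; apply: ler_sum => i _.
have yi : `|y i 0| <= M + `|z i 0|.
  by rewrite mxE; apply: le_trans (ler_normD _ _) _; rewrite lerD2r; exact: Mx.
have zi : `|z i 0| <= 1 + z i 0 ^+ 2.
  by rewrite -real_normK ?num_real//; have := normr_ge0 (z i 0); nra.
have : M * `|y i 0| <= M * (M + (1 + z i 0 ^+ 2)) by rewrite ler_wpM2l//; lra.
lra.
Qed.

Lemma integrable_info_bound : gamma.-integrable setT (EFin \o info_bound).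
Proof.
have -> : EFin \o info_bound = (fun z => \sum_(i < nr)
    (((2 * M)%:E * (z i 0 ^+ 2)%:E) + (2 * M * (M + 1) + M ^+ 2)%:E))%E.
  by apply/funext => z; rewrite /= /info_bound -sumEFin.
apply: integrable_sum => // i _; apply: integrableD => //.
  apply: integrableZl => //; apply/integrableP; split.
    by apply/measurable_EFinP; apply: measurable_funX; exact: measurable_entry.
  apply: le_lt_trans (ltry 1).
  under eq_integral do rewrite gee0_abs ?lee_fin ?sqr_ge0//.
  exact: integral_std_gaussian_sqr_le1.
exact: finite_measure_integrable_cst.
Qed.

Lemma measurable_info_density (F : probability 'cV[R]_nt R) :
  measurable_fun setT (info_density F).
Proof.
apply: measurable_funB; apply: measurableT_comp; [exact: measurable_ln| |exact: measurable_ln|].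
  exact: measurable_shift_density.
exact: (measurableT_comp (measurable_output_density H F) measurable_snd).
Qed.

End bounded_input.

Section information_formula.
Context {R : realType} (nt nr : nat) (H : 'M[R]_(nr, nt)) (M : R).
Hypothesis M0 : 0 <= M.
Local Notation gamma := (@std_gaussian R nr).
Variable F : probability 'cV[R]_nt R.
Hypothesis FM : F (bounded_image H M) = 1%E.
Local Notation P := (product_prob F gamma).
Local Notation joint := (distribution P
  (@pair_RV R _ _ _ _ _ _ P (channel_input (nr := nr)) (channel_output H))).
Local Notation indep := (product_prob (distribution P (channel_input (nr := nr)))
  (distribution P (channel_output H))).
Local Open Scope ereal_scope.

Lemma expR_info_density w : (expR (info_density H F w) * output_density H F w.2 =
  gaussian_shift (H *m w.1) w.2)%R.
Proof.
have q0 := output_density_gt0 M0 FM w.2.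
by rewrite expRB !lnK ?posrE ?gaussian_shift_gt0// divfK// gt_eqF.
Qed.

(** Both sides become integrals over [F] and [gamma]: the joint law contributes the density [g], the
    product of the marginals contributes [q], and [q] times the exponential is [g] again. *)
Lemma joint_law_density (A : set ('cV[R]_nt * 'cV[R]_nr)) : measurable A ->
  joint A = \int[indep]_(w in A) (expR (info_density H F w))%:E.
Proof.
move=> mA; rewrite [RHS]integral_mkcond.
have mh : measurable_fun setT (fun w => (expR (info_density H F w))%:E).
  by apply/measurable_EFinP; apply: measurableT_comp => //; exact: measurable_info_density.
set h := _ \_ _; have mhA : measurable_fun setT h.
  by apply/(measurable_restrictT _ mA); exact: measurable_funTS.
have h0 w : 0 <= h w by rewrite /h patchE; case: ifP => //; rewrite lee_fin expR_ge0.
rewrite fubini_tonelli1// /fubini_F.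
transitivity (\int[P]_w (\1_A (w.1, channel_output H w) : R)%:E).
  rewrite -[RHS](@ge0_integral_distribution _ _ _ _ _ P
    (@pair_RV R _ _ _ _ _ _ P (channel_input (nr := nr)) (channel_output H))
    (fun w => (\1_A w : R)%:E)).
  - by rewrite integral_indic// setIT.
  - exact/measurable_EFinP/measurable_indic.
  - by move=> w; rewrite lee_fin.
rewrite (@ge0_integral_channel_joint _ _ _ H F (fun w => (\1_A w : R)%:E)); last 2 first.
- exact/measurable_EFinP/measurable_indic.
- by move=> w; rewrite lee_fin.
rewrite [RHS]ge0_integral_distribution; last 2 first.
- exact: measurable_fun_fubini_tonelli_F.
- by move=> x; apply: integral_ge0.
rewrite (@ge0_integral_channel_input _ _ _ F
  (fun x => \int[distribution P (channel_output H)]_y h (x, y))); last 2 first.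
- exact: measurable_fun_fubini_tonelli_F.
- by move=> x; apply: integral_ge0.
apply: eq_integral => x _.
have mhx : measurable_fun setT (fun y => h (x, y)).
  exact: (measurableT_comp mhA (pair1_measurable x)).
rewrite [RHS](@ge0_integral_distribution _ _ _ _ _ P (channel_output H)
  (fun y => h (x, y)) mhx (fun y => h0 (x, y))).
rewrite [RHS](@ge0_integral_channel_output _ _ _ H F (fun y => h (x, y)) mhx
  (fun y => h0 (x, y))).
apply: eq_integral => y _; rewrite /h patchE indicE.
case: ifP => _; last by rewrite !mul0e.
by rewrite mul1e -EFinM (expR_info_density (x, y)).
Qed.

Lemma integrable_info_density :
  P.-integrable setT (fun w => (info_density H F (w.1, channel_output H w))%:E).
Proof.
have mi : measurable_fun setT (fun w => (info_density H F (w.1, channel_output H w))%:E).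
  apply/measurable_EFinP; apply: (measurableT_comp (measurable_info_density H F)).
  by apply: measurable_fun_pair; [exact: measurable_fst|exact: measurable_channel_output].
(* Applied to a constant sequence, for the integrability of the limit that it also provides. *)
have := @dominated_convergence _ _ _ P setT measurableT
  (fun=> (fun w => (info_density H F (w.1, channel_output H w))%:E))
  (fun w => (info_density H F (w.1, channel_output H w))%:E)
  (fun w => (info_bound M w.2)%:E) (fun=> mi) mi.
case=> //.
- by apply: aeW => w _; exact: cvg_cst.
- exact: (@integrable_product_snd _ _ _ _ R F gamma _ (@integrable_info_bound R nr M)).
- apply: filterS (ae_product_fst gamma (bounded_image_ae FM)) => -[x z] /= Mx _ _.
  by rewrite lee_fin; exact: info_density_le.
Qed.

Lemma channel_informationE : channel_information H F =
  \int[P]_w (info_density H F (w.1, channel_output H w) / ln 2)%:E.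
Proof.
have mh : measurable_fun setT (fun w => (expR (info_density H F w))%:E).
  by apply/measurable_EFinP; apply: measurableT_comp => //; exact: measurable_info_density.
rewrite /channel_information /mutual_information /relative_entropy.
have dom : joint `<< indep := density_dominates mh joint_law_density.
rewrite (asboolT dom).
have mlog : measurable_fun setT (fun x : R => log2 x).
  by apply: measurable_funM => //; exact: measurable_ln.
transitivity (\int[joint]_w (info_density H F w / ln 2)%:E).
  apply: ae_eq_integral => //.
  - apply/measurable_EFinP; apply: (measurableT_comp mlog).
    apply: (measurableT_comp (fine_measurable measurableT)).
    exact: (measurable_int _ (@Radon_Nikodym_integrable _ _ _
      (charge_of_finite_measure joint) indep dom)).
  - by apply/measurable_EFinP; apply: measurable_funM => //; exact: measurable_info_density.
  - apply: filterS (ae_eq_Radon_Nikodym mh joint_law_density) => w + _ => -> //.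
    by rewrite /log2/= expRK.
rewrite integral_distribution//.
- by apply/measurable_EFinP; apply: measurable_funM => //; exact: measurable_info_density.
- rewrite (_ : _ \o _ =
    (fun w => (info_density H F (w.1, channel_output H w))%:E * (ln 2)^-1%:E)).
    exact: integrableZr integrable_info_density.
  by apply/funext => w; rewrite -EFinM.
Qed.

Lemma channel_information_fine : channel_information H F =
  (fine (\int[P]_w (info_density H F (w.1, channel_output H w))%:E) / ln 2)%:E.
Proof.
rewrite channel_informationE EFinM fineK.
  rewrite -(integralZr measurableT integrable_info_density).
  by apply: eq_integral => w _; rewrite EFinM.
exact: (integrable_fin_num measurableT integrable_info_density).
Qed.

End information_formula.

(** * The lower bound for a fixed input law *)

(** The common form of both uses of a tangent line to [ln]. As [u] is nonnegative, its integral can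
    be computed by Tonelli before integrability is known. *)
Lemma integral_lower_bound d (T : measurableType d) (R : realType)
    (P : probability T R) (f u : T -> R) (c U : R) :
  P.-integrable setT (EFin \o f) -> measurable_fun setT u -> (forall x, 0 <= u x) ->
  (\int[P]_x (u x)%:E <= U%:E)%E -> (forall x, c - u x <= f x) ->
  c - U <= fine (\int[P]_x (f x)%:E)%E.
Proof.
move=> fi mu u0 uU fu; rewrite -lee_fin fineK; last exact: integrable_fin_num fi.
have ui : P.-integrable setT (EFin \o u).
  apply/integrableP; split; first exact/measurable_EFinP.
  apply: le_lt_trans (ltry U); apply: le_trans uU.
  by apply: ge0_le_integral => //; [exact/measurable_EFinP/measurableT_comp|
    exact/measurable_EFinP|move=> x _; rewrite /= lee_fin ger0_norm].
have cE : (\int[P]_x (cst c%:E x) = c%:E)%E.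
  by rewrite integral_cst// [X in (_ * X)%E]probability_setT mule1.
apply: (@le_trans _ _ (c%:E - \int[P]_x (u x)%:E)%E).
  by rewrite EFinB leeD2l// leeN2.
rewrite -cE -(integralB_EFin (f1 := cst c) measurableT)//; last first.
  exact: finite_measure_integrable_cst.
apply: le_integral => //.
  apply: integrableB => //; exact: finite_measure_integrable_cst.
by move=> x _; rewrite -EFinB lee_fin; exact: fu.
Qed.

Lemma integral_probability_cst d (T : measurableType d) (R : realType)
    (P : probability T R) (r : R) : (\int[P]_x (cst r%:E x) = r%:E)%E.
Proof. by rewrite integral_cst// [X in (_ * X)%E]probability_setT mule1. Qed.

Lemma ln_le_sub1 {R : realType} (t : R) : 0 < t -> ln t <= t - 1.
Proof. by move=> t0; rewrite -{1}(subrK 1 t) addrC; apply: le_ln1Dx; lra. Qed.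

Lemma ge0_integral_product_snd d1 d2 (T1 : measurableType d1) (T2 : measurableType d2)
    (R : realType) (P : probability T1 R) (Q : probability T2 R) (f : T2 -> \bar R) :
  measurable_fun setT f -> (forall y, 0 <= f y)%E ->
  (\int[product_prob P Q]_w f w.2 = \int[Q]_y f y)%E.
Proof.
move=> mf f0; have mf2 : measurable_fun setT (fun w : T1 * T2 => f w.2).
  exact: (measurableT_comp mf measurable_snd).
rewrite [LHS](@fubini_tonelli1 _ _ _ _ _ P Q _ mf2 (fun w => f0 w.2)) /fubini_F/=.
by rewrite integral_cst// [X in (_ * X)%E]probability_setT mule1.
Qed.

Section lower_bound.
Context {R : realType} (nt nr : nat) (H : 'M[R]_(nr, nt)) (M : R).
Hypothesis M0 : 0 <= M.
Variable F : probability 'cV[R]_nt R.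
Hypothesis FM : F (bounded_image H M) = 1%E.
Local Notation gamma := (@std_gaussian R nr).
Local Notation P := (product_prob F gamma).

Let info w := info_density H F (w.1, channel_output H w).

Lemma channel_information_ge0 : (0 <= channel_information H F)%E.
Proof.
rewrite (channel_information_fine M0 FM) lee_fin divr_ge0//; last by rewrite ln_ge0// ler1n.
(* The constants are [c = U = 1]. *)
rewrite -(subrr 1).
(* This is [q / g]; its mean under the joint density [g] is the total mass of [q], which is 1. *)
pose u (w : 'cV[R]_nt * 'cV[R]_nr) := expR (- info_density H F w).
have mu : measurable_fun setT u.
  apply: measurableT_comp => //; apply: measurableT_comp => //.
  exact: measurable_info_density.
apply: (@integral_lower_bound _ _ _ P info (fun w => u (w.1, channel_output H w))).
- exact: (integrable_info_density M0 FM).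
- apply: measurableT_comp => //.
  by apply: measurable_fun_pair; [exact: measurable_fst|exact: measurable_channel_output].
- by move=> w; exact: expR_ge0.
- rewrite (@ge0_integral_channel_joint _ _ _ H F (fun w => (u w)%:E)); last 2 first.
  + exact/measurable_EFinP.
  + by move=> w; rewrite lee_fin expR_ge0.
  have q1 : (\int[gamma]_y (output_density H F y)%:E = 1)%E.
    have := @ge0_integral_channel_output _ _ _ H F (cst 1%E) (measurable_cst _) (fun=> lee01).
    rewrite integral_probability_cst => ->.
    by apply: eq_integral => y _; rewrite mul1e.
  have -> : (\int[F]_x \int[gamma]_y ((u (x, y))%:E * (gaussian_shift (H *m x) y)%:E) =
    \int[F]_x (cst 1%E x))%E.
    apply: eq_integral => x _; rewrite -[RHS]q1; apply: eq_integral => y _.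
    rewrite -EFinM; congr EFin; rewrite -(expR_info_density M0 FM (x, y))/=.
    by rewrite mulrA -expRD addNr expR0 mul1r.
  by rewrite integral_probability_cst.
- move=> w; have := expR_ge1Dx (- info w); rewrite /u /info; lra.
Qed.

(** The integrand of [overlap], in the coordinatewise form in which [integral_std_gaussian_gauss]
    produces it. *)
Definition pair_kernel (w : 'cV[R]_nt * 'cV[R]_nt) : R :=
  expR (- (\sum_i ((H *m w.1) i 0 - (H *m w.2) i 0) ^+ 2 / 4)).

Lemma measurable_pair_kernel : measurable_fun setT pair_kernel.
Proof.
apply: measurableT_comp => //; apply: measurableT_comp => //.
apply: measurable_sum => i; apply: measurable_funM => //; apply: measurable_funX.
have m : measurable_fun setT (fun x : 'cV[R]_nt => (H *m x) i 0).
  exact: (measurableT_comp (measurable_entry i 0) (measurable_mulmx H)).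
apply: measurable_funB; first exact: (measurableT_comp m measurable_fst).
exact: (measurableT_comp m measurable_snd).
Qed.

Lemma overlapE : overlap H F = (\int[product_prob F F]_w (pair_kernel w)%:E)%E.
Proof.
rewrite /overlap unlock; apply: eq_integral => w _; congr (expR (- _))%:E.
rewrite /enorm sqr_sqrtr; last by apply: sumr_ge0 => i _; exact: sqr_ge0.
rewrite mulr_suml; apply: eq_bigr => i _; congr (_ ^+ 2 / 4).
by rewrite mulmxBr !mxE.
Qed.

Lemma overlap_fin : (fine (overlap H F))%:E = overlap H F.
Proof.
apply: fineK; rewrite overlapE ge0_fin_numE; last first.
  by apply: integral_ge0 => w _; rewrite lee_fin expR_ge0.
apply: (@le_lt_trans _ _ (\int[product_prob F F]_w (cst 1%E w))%E).
  apply: ge0_le_integral => //.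
  - by move=> w _; rewrite lee_fin expR_ge0.
  - by apply/measurable_EFinP; exact: measurable_pair_kernel.
  - move=> w _; rewrite lee_fin expR_le1 oppr_le0; apply: sumr_ge0 => i _.
    by rewrite divr_ge0// sqr_ge0.
by rewrite integral_probability_cst ltry.
Qed.

(** Two numbers of modulus at most [M] satisfy [(a - b)^2 / 4 <= M^2], so the kernel is almost
    everywhere at least a positive constant. Positivity matters because the bound inverts the
    overlap, and [0^-1] is 0 by convention. *)
Lemma overlap_gt0 : 0 < fine (overlap H F).
Proof.
suff : ((expR (- (\sum_(i < nr) M ^+ 2)))%:E <= overlap H F)%E.
  by rewrite -overlap_fin lee_fin; apply: lt_le_trans; exact: expR_gt0.
rewrite overlapE -(integral_probability_cst (product_prob F F)).
apply: ae_ge0_le_integral => //.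
- by move=> w _; rewrite lee_fin expR_ge0.
- by move=> w _; rewrite lee_fin expR_ge0.
- by apply/measurable_EFinP; exact: measurable_pair_kernel.
have bae := bounded_image_ae FM.
have h1 := ae_product_fst F bae; have h2 := ae_product_snd F bae.
near=> w => _; rewrite lee_fin ler_expR lerN2; apply: ler_sum => i _.
have w1 : bounded_image H M w.1 by near: w.
have w2 : bounded_image H M w.2 by near: w.
have := w1 i; have := w2 i; rewrite !ler_norml => /andP[a1 a2] /andP[b1 b2].
nra.
Unshelve. all: by end_near. Qed.

(** Up to the factor [(2 pi)^(- nr / 2)], the density of the output with respect to Lebesgue
    measure. *)
Definition tilted_density (y : 'cV[R]_nr) : R :=
  output_density H F y * expR (- (\sum_i y i 0 ^+ 2 / 2)).

Lemma measurable_tilted_density : measurable_fun setT tilted_density.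
Proof.
apply: measurable_funM; first exact: measurable_output_density.
apply: measurableT_comp => //; apply: measurableT_comp => //.
apply: measurable_sum => i; apply: measurable_funM => //; apply: measurable_funX.
exact: measurable_entry.
Qed.

Lemma tilted_density_gt0 y : 0 < tilted_density y.
Proof. by rewrite mulr_gt0 ?expR_gt0// (output_density_gt0 M0 FM). Qed.

(* Up to a constant, the left-hand side is the integral of the squared output
   density with respect to Lebesgue measure. *)
Lemma integral_tilted_density :
  (\int[P]_w (tilted_density (channel_output H w))%:E =
  ((Num.sqrt 2)^-1 ^+ nr)%:E * overlap H F)%E.
Proof.
have mt : measurable_fun setT (fun w : 'cV[R]_nt * 'cV[R]_nr => (tilted_density w.2)%:E).
  by apply/measurable_EFinP; exact: (measurableT_comp measurable_tilted_density measurable_snd).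
have t0 y : (0 <= (tilted_density y)%:E)%E by rewrite lee_fin ltW// tilted_density_gt0.
have mk : measurable_fun setT (fun w => (pair_kernel w)%:E).
  by apply/measurable_EFinP; exact: measurable_pair_kernel.
have mg x : measurable_fun setT (fun y => (gaussian_shift (H *m x) y)%:E).
  by apply/measurable_EFinP; apply: measurable_gaussian_shift.
have k0 w : (0 <= (pair_kernel w)%:E)%E by rewrite lee_fin expR_ge0.
have s0 : (0 <= ((Num.sqrt 2)^-1 ^+ nr)%:E :> \bar R)%E.
  by rewrite lee_fin exprn_ge0// invr_ge0 sqrtr_ge0.
rewrite (@ge0_integral_channel_joint _ _ _ H F (fun w => (tilted_density w.2)%:E) mt
  (fun w => t0 w.2)).
rewrite overlapE [X in (_ * X)%E](@fubini_tonelli1 _ _ _ _ _ F F _ mk k0).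
rewrite -ge0_integralZl; last first.
- exact: s0.
- by move=> x _; apply: integral_ge0.
- exact: (measurable_fun_fubini_tonelli_F _ mk k0).
- exact: measurableT.
apply: eq_integral => x _; rewrite /fubini_F.
pose e (y : 'cV[R]_nr) : R := expR (- (\sum_i y i 0 ^+ 2 / 2)).
have me : measurable_fun setT e.
  apply: measurableT_comp => //; apply: measurableT_comp => //.
  apply: measurable_sum => i; apply: measurable_funM => //; apply: measurable_funX.
  exact: measurable_entry.
(* At fixed [x], the density [q(y)] is expanded as an average over an independent copy [x'], so that
   the integral over [y] can be taken first. *)
pose k3 (w : 'cV[R]_nt * 'cV[R]_nr) : \bar R :=
  (gaussian_shift (H *m x) w.2 * gaussian_shift (H *m w.1) w.2 * e w.2)%:E.
have mk3 : measurable_fun setT k3.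
  apply/measurable_EFinP; apply: measurable_funM; last first.
    exact: (measurableT_comp me measurable_snd).
  apply: measurable_funM; last exact: measurable_shift_density.
  by apply: measurable_gaussian_shift => //; exact: measurable_snd.
have k30 w : (0 <= k3 w)%E.
  by rewrite lee_fin mulr_ge0 ?expR_ge0// mulr_ge0// gaussian_shift_ge0.
transitivity (\int[gamma]_y \int[F]_x' k3 (x', y))%E.
  apply: eq_integral => y _; rewrite -EFinM /tilted_density.
  rewrite mulrC mulrCA EFinM output_densityE -ge0_integralZr.
  - by apply: eq_integral => x' _; rewrite -EFinM; congr EFin; rewrite mulrA [X in X * _]mulrC.
  - exact: measurableT.
  - apply/measurable_EFinP; apply: measurable_gaussian_shift => //; exact: measurable_mulmx.
  - by move=> x' _; rewrite lee_fin gaussian_shift_ge0.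
  - by rewrite lee_fin; apply: mulr_ge0; [exact: gaussian_shift_ge0|exact: expR_ge0].
rewrite -(@fubini_tonelli _ _ _ _ _ F gamma k3 mk3 k30).
transitivity (\int[F]_x' (((Num.sqrt 2)^-1 ^+ nr)%:E * (pair_kernel (x, x'))%:E))%E.
  apply: eq_integral => x' _; rewrite -EFinM.
  exact: (integral_std_gaussian_gauss (H *m x) (H *m x')).
rewrite ge0_integralZl//; exact: (measurableT_comp mk (pair1_measurable x)).
Qed.

(** Nonnegativity of the information reduces the positive part to the plain logarithm; the rest is
    [integral_lower_bound] with the tangent to [ln] at the mean of [tilted_density]. *)
Lemma overlap_bound_le : ((overlap_bound H F)%:E <= channel_information H F)%E.
Proof.
have ln2 : 0 < ln 2 :> R by rewrite ln_gt0// ltr1n.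
have := channel_information_ge0; rewrite (channel_information_fine M0 FM) !lee_fin => I0.
rewrite /overlap_bound /log2_plus ge_max I0 andbT /log2 ler_pM2r ?invr_gt0//.
have v0 := overlap_gt0; set v := fine (overlap H F) in v0 *.
pose a : R := (Num.sqrt 2)^-1 ^+ nr * v.
have s0 : 0 < (Num.sqrt 2 : R) by rewrite sqrtr_gt0.
have a0 : 0 < a by rewrite mulr_gt0// exprn_gt0// invr_gt0.
have lns : ln (Num.sqrt 2 : R) = ln 2 / 2.
  have : ln (Num.sqrt 2 ^+ 2 : R) = ln 2 by rewrite sqr_sqrtr.
  by rewrite lnXn// => <-; rewrite mulr2n; field.
have lna : ln a = - (nr%:R * (ln 2 / 2)) + ln v.
  rewrite /a lnM ?posrE// ?exprn_gt0 ?invr_gt0// lnXn ?invr_gt0// lnV ?posrE// lns.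
  by rewrite mulNrn mulr_natl.
(* The shape [c - U]: the tangent constant is [c = 1 - ln a], while [nr / 2] bounds the mean of
   [|Z|^2 / 2] and 1 is the mean of [tilted_density / a]. *)
have -> : ln ((2 / expR 1) `^ (nr%:R / 2) * v^-1) = (1 - ln a) - (nr%:R / 2 + 1).
  rewrite lnM ?posrE ?powR_gt0 ?invr_gt0 ?divr_gt0 ?expR_gt0//.
  by rewrite ln_powR ln_div ?posrE ?expR_gt0// expRK lnV ?posrE// lna; field.
pose u (w : 'cV[R]_nt * 'cV[R]_nr) :=
  \sum_i w.2 i 0 ^+ 2 / 2 + a^-1 * tilted_density (channel_output H w).
have mu1 i : measurable_fun setT (fun w : 'cV[R]_nt * 'cV[R]_nr => (w.2 i 0 ^+ 2 / 2)).
  apply: measurable_funM => //; apply: measurable_funX.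
  exact: (measurableT_comp (measurable_entry i 0) measurable_snd).
have mu2 : measurable_fun setT
    (fun w : 'cV[R]_nt * 'cV[R]_nr => tilted_density (channel_output H w)).
  exact: (measurableT_comp measurable_tilted_density (measurable_channel_output H)).
apply: (@integral_lower_bound _ _ _ P info u).
- exact: (integrable_info_density M0 FM).
- by apply: measurable_funD; [exact: measurable_sum|exact: measurable_funM].
- move=> w; apply: addr_ge0; first by apply: sumr_ge0 => i _; rewrite divr_ge0// sqr_ge0.
  by rewrite mulr_ge0 ?invr_ge0 ?ltW// tilted_density_gt0.
- pose r w := (a^-1 * tilted_density (channel_output H w))%:E.
  have mr : measurable_fun setT r by apply/measurable_EFinP; exact: measurable_funM.
  have r0 w : (0 <= r w)%E.
    by rewrite lee_fin mulr_ge0 ?invr_ge0 ?ltW// tilted_density_gt0.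
  pose sq i (w : 'cV[R]_nt * 'cV[R]_nr) := (w.2 i 0 ^+ 2 / 2)%:E.
  have msq i : measurable_fun setT (sq i) by apply/measurable_EFinP; exact: mu1.
  have sq0 i w : (0 <= sq i w)%E by rewrite lee_fin divr_ge0// sqr_ge0.
  have -> : (\int[P]_w (u w)%:E = \int[P]_w (\sum_i sq i w + r w))%E.
    by apply: eq_integral => w _; rewrite /u /sq /r EFinD sumEFin.
  have msum : measurable_fun setT (fun w => \sum_i sq i w)%E.
    exact: emeasurable_sum.
  have sum0 w : (0 <= \sum_i sq i w)%E by apply: sume_ge0.
  rewrite (@ge0_integralD _ _ _ P setT measurableT (fun w => \sum_i sq i w)%E r
    (fun w _ => sum0 w) msum (fun w _ => r0 w) mr).
  rewrite EFinD; apply: leeD.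
    rewrite (@ge0_integral_sum _ _ _ P setT measurableT _ sq msq (fun i w _ => sq0 i w)).
    have -> : (nr%:R / 2)%:E = (\sum_(i < nr) (2^-1)%:E)%E :> \bar R.
      by rewrite sumEFin sumr_const card_ord mulr_natl.
    apply: lee_sum => i _.
    have mz : measurable_fun setT (fun z : 'cV[R]_nr => (z i 0 ^+ 2)%:E).
      by apply/measurable_EFinP; apply: measurable_funX; exact: measurable_entry.
    have -> : (\int[P]_w sq i w =
        (2^-1)%:E * \int[gamma]_z (z i 0 ^+ 2)%:E)%E.
      rewrite -(@ge0_integral_product_snd _ _ _ _ _ F gamma _ mz); last first.
        by move=> z; rewrite lee_fin sqr_ge0.
      rewrite -ge0_integralZl.
      - by apply: eq_integral => w _; rewrite /sq mulrC EFinM.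
      - exact: measurableT.
      - exact: (measurableT_comp mz measurable_snd).
      - by move=> w _; rewrite lee_fin sqr_ge0.
      - by rewrite lee_fin.
    rewrite -[leRHS]mule1; apply: lee_wpmul2l; first by rewrite lee_fin.
    exact: integral_std_gaussian_sqr_le1.
  have -> : (\int[P]_w r w =
      (a^-1)%:E * \int[P]_w (tilted_density (channel_output H w))%:E)%E.
    rewrite -ge0_integralZl.
    - by apply: eq_integral => w _; rewrite /r EFinM.
    - exact: measurableT.
    - exact/measurable_EFinP.
    - by move=> w _; rewrite lee_fin ltW// tilted_density_gt0.
    - by rewrite lee_fin invr_ge0 ltW.
  by rewrite integral_tilted_density -overlap_fin -!EFinM lee_fin mulVf// gt_eqF.
- move=> [x z]; rewrite /info /info_density /u /=; set y := channel_output H (x, z).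
  have q0 := output_density_gt0 M0 FM y; have r0 := tilted_density_gt0 y.
  have := ln_le_sub1 (divr_gt0 r0 a0); rewrite ln_div ?posrE//.
  rewrite {1}/tilted_density lnM ?posrE ?expR_gt0// expRK /gaussian_shift expRK.
  (* Complete the square, using [y - Hx = z]. *)
  have -> : \sum_i ((H *m x) i 0 * y i 0 - (H *m x) i 0 ^+ 2 / 2) =
      \sum_i (y i 0 ^+ 2 / 2) - \sum_i (z i 0 ^+ 2 / 2).
    rewrite -sumrB; apply: eq_bigr => i _.
    have -> : y i 0 = (H *m x) i 0 + z i 0 by rewrite [LHS]mxE.
    by field.
  rewrite [_ / a]mulrC; lra.
Qed.

End lower_bound.

(** * Schoenberg's space-filling curve *)

Section digit_series.
Context {R : realType}.
Variable r : R.
Hypotheses (r0 : 0 <= r) (r1 : r < 1).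

Definition digit_series (a : R^nat) : R := limn (series (fun i => a i * r ^+ i)).

Lemma digit_series_cvg (a : R^nat) : (forall i, 0 <= a i <= 1) ->
  cvgn (series (fun i => a i * r ^+ i)).
Proof.
move=> a01; apply: (@series_le_cvg R _ (geometric 1 r)).
- by move=> i; case/andP: (a01 i) => ? _; rewrite mulr_ge0 ?exprn_ge0.
- by move=> i; rewrite /geometric/= mul1r exprn_ge0.
- by move=> i; case/andP: (a01 i) => _ ?; rewrite /geometric/= ler_wpM2r ?exprn_ge0.
- by apply: is_cvg_geometric_series; rewrite ger0_norm.
Qed.

Lemma digit_series_bounds (a : R^nat) : (forall i, 0 <= a i <= 1) ->
  0 <= digit_series a <= (1 - r)^-1.
Proof.
move=> a01; apply/andP; split.
  apply: limr_ge; first exact: digit_series_cvg.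
  apply: nearW => n; apply: sumr_ge0 => i _.
  by case/andP: (a01 i) => ? _; rewrite mulr_ge0 ?exprn_ge0.
have g1 : `|r| < 1 by rewrite ger0_norm.
rewrite -[leRHS]mul1r -(cvg_lim _ (@cvg_geometric_series R 1 r g1))//.
apply: lim_series_le; [exact: digit_series_cvg|exact: is_cvg_geometric_series|move=> i].
by case/andP: (a01 i) => _ ?; rewrite /geometric/= ler_wpM2r ?exprn_ge0.
Qed.

Lemma digit_seriesS (a : R^nat) : (forall i, 0 <= a i <= 1) ->
  digit_series a = a 0%N + r * digit_series (fun i => a i.+1).
Proof.
move=> a01; apply: cvg_lim => //; rewrite -cvg_shiftS.
have -> : [sequence series (fun i => a i * r ^+ i) n.+1]_n =
    (fun n => a 0%N + r * series (fun i => a i.+1 * r ^+ i) n).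
  apply/funext => n; rewrite /series/= big_nat_recl//= expr0 mulr1; congr (_ + _).
  by rewrite mulr_sumr; apply: eq_bigr => i _; rewrite exprS mulrCA.
apply: cvgD; first exact: cvg_cst.
by apply: cvgMr; apply: digit_series_cvg => i; exact: a01.
Qed.

Lemma digit_series_split (a : R^nat) n : (forall i, 0 <= a i <= 1) ->
  digit_series a = \sum_(i < n) a i * r ^+ i + r ^+ n * digit_series (fun i => a (n + i)%N).
Proof.
move=> a01; elim: n => [|n IHn]; first by rewrite big_ord0 add0r expr0 mul1r.
rewrite {}IHn big_ord_recr/= -addrA; congr (_ + _).
rewrite digit_seriesS// addn0 mulrDr mulrC; congr (_ + _).
rewrite mulrA exprSr; congr (_ * digit_series _).
by apply/funext => i; rewrite addnS.
Qed.

(** The tails are uniformly small. They are also nonnegative, so two of them lie in [[0, e / 2)] and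
    differ by less than [e / 2], which leaves [e / 2] for the continuous partial sum. *)
Lemma digit_series_continuous (f : nat -> R -> R) :
  (forall i, continuous (f i)) -> (forall i t, 0 <= f i t <= 1) ->
  continuous (fun t => digit_series (f ^~ t)).
Proof.
move=> cf f01 t; apply/cvgrPdist_lt => e e0.
have c0 : 0 < (1 - r)^-1 by rewrite invr_gt0 subr_gt0.
have [N rN] : exists N, r ^+ N * (1 - r)^-1 < e / 2.
  have : r ^+ n @[n --> \oo] --> (0 : R) by apply: cvg_expr; rewrite ger0_norm.
  move/cvgrPdist_lt => /(_ (e / 2 * (1 - r))).
  case; first by rewrite mulr_gt0 ?divr_gt0// subr_gt0.
  move=> N _ /(_ N); rewrite /= sub0r normrN ger0_norm ?exprn_ge0// => h.
  by exists N; rewrite ltr_pdivrMr ?subr_gt0//; exact: h.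
pose S t := \sum_(i < N) f i t * r ^+ i.
have cS : continuous S.
  rewrite /S; elim: N {rN S} => [|n IHn].
    rewrite (_ : (fun _ => _) = cst 0); first by move=> u; exact: cvg_cst.
    by apply/funext => u; rewrite big_ord0.
  rewrite (_ : (fun _ => _) = (fun u => (\sum_(i < n) f i u * r ^+ i) + f n u * r ^+ n)).
    by move=> u; apply: cvgD; [exact: IHn|apply: cvgM; [exact: cf|exact: cvg_cst]].
  by apply/funext => u; rewrite big_ord_recr.
have tail u : 0 <= digit_series (f ^~ u) - S u <= r ^+ N * (1 - r)^-1.
  rewrite (@digit_series_split _ N)// -/(S u) addrAC subrr add0r.
  have /andP[b1 b2] := @digit_series_bounds (fun i => f (N + i)%N u) (fun i => f01 _ u).
  by rewrite mulr_ge0 ?exprn_ge0//= ler_wpM2l ?exprn_ge0.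
have e2 : 0 < e / 2 by rewrite divr_gt0.
have /cvgrPdist_lt/(_ _ e2) := cS t; apply: filterS => u.
have := tail t; have := tail u; move: (S u) (S t) => su st.
move=> /andP[a1 a2] /andP[b1 b2]; rewrite !ltr_norml => /andP[d1 d2].
by apply/andP; split; lra.
Qed.

End digit_series.

Section schoenberg.
Context {R : realType}.
Local Notation e10 := (10^-1 : R).
Local Notation half := (2^-1 : R).

(** The function [min (max x 0) 1], written with absolute values so that continuity is immediate. *)
Definition clamp01 (x : R) : R := (`|x| - `|x - 1| + 1) / 2.

Lemma clamp01_continuous : continuous clamp01.
Proof.
move=> x; apply: cvgM; last exact: cvg_cst.
apply: cvgD; last exact: cvg_cst.
apply: cvgB; apply: cvg_norm; first exact: cvg_id.
by apply: cvgB; [exact: cvg_id|exact: cvg_cst].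
Qed.

Lemma clamp01_bounds x : 0 <= clamp01 x <= 1.
Proof.
rewrite /clamp01; have := ler_distD 0 x 1; have := ler_distD 1 x 0.
have := ler_distD x 0 1; rewrite !subr0 !sub0r normrN normr1 normrN.
by move=> a b c; apply/andP; split; lra.
Qed.

Lemma clamp01_le0 x : x <= 0 -> clamp01 x = 0.
Proof. by move=> x0; rewrite /clamp01 !ler0_norm ?subr_le0//; lra. Qed.

Lemma clamp01_ge1 x : 1 <= x -> clamp01 x = 1.
Proof. by move=> x1; rewrite /clamp01 !ger0_norm ?subr_ge0//; lra. Qed.

(** Schoenberg's function is piecewise linear; the clamped cosine keeps what matters: continuity,
    period 2, the value 0 just after even integers and 1 just after odd ones. *)
Definition zigzag (t : R) : R := clamp01 (2^-1 - cos (pi * t)).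

Lemma zigzag_continuous : continuous zigzag.
Proof.
move=> t; apply: (@continuous_cvg _ _ _ _ _ (fun t => 2^-1 - cos (pi * t)) clamp01).
  exact: clamp01_continuous.
apply: cvgB; first exact: cvg_cst.
apply: (@continuous_cvg _ _ _ _ _ (fun t => pi * t) cos); first exact: continuous_cos.
exact: mulrl_continuous.
Qed.

(** From [cos (2 x) >= 0] one gets [2 (cos x)^2 >= 1]. *)
Lemma cos_ge_half (x : R) : 0 <= x <= pi / 4 -> 2^-1 <= cos x.
Proof.
move=> /andP[x0 x4]; have pi0 := pi_gt0 R.
have c0 : 0 <= cos x by apply: cos_ge0_pihalf; apply/andP; split; lra.
have c2 : 0 <= cos (x + x) by apply: cos_ge0_pihalf; apply/andP; split; lra.
have e2 : cos (x + x) = cos x ^+ 2 + cos x ^+ 2 - 1 by rewrite -[x + x]mulr2n cos_mulr2n.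
nra.
Qed.

Lemma zigzag_digit k (b : bool) (s : R) : 0 <= s <= 4^-1 ->
  zigzag ((2 * k)%:R + (b%:R + s)) = b%:R.
Proof.
move=> /andP[s0 s4]; have pi0 := pi_gt0 R.
have c : 2^-1 <= cos (pi * s) by apply: cos_ge_half; apply/andP; split; nra.
rewrite /zigzag natrM mulrDr.
have -> : pi * (2 * k%:R) + pi * (b%:R + s) = pi * (b%:R + s) + pi *+ 2 *+ k :> R.
  by rewrite -mulrnA -[pi *+ _]mulr_natr natrM; ring.
rewrite (periodicn (@cosD2pi R)); case: b => /=.
  rewrite (_ : pi * (1 + s) = pi * s + pi); last by ring.
  rewrite cosDpi clamp01_ge1//; lra.
by rewrite add0r clamp01_le0//; lra.
Qed.

(** The base is even and large: modulo 2, [10 ^+ m * decimal b] is [b m] plus a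
    tail in [[0, 1/4]], where [zigzag] is constant. *)
Definition decimal (b : nat -> bool) : R := digit_series e10 (fun i => (b i)%:R).

Lemma bool01 (b : bool) : 0 <= (b%:R : R) <= 1.
Proof. by case: b; rewrite /= ?lexx ?ler01. Qed.

Let e10_ge0 : 0 <= e10. Proof. by rewrite invr_ge0. Qed.
Let e10_lt1 : e10 < 1. Proof. by rewrite invf_lt1 ?ltr1n. Qed.
Let half_ge0 : 0 <= half. Proof. by rewrite invr_ge0. Qed.
Let half_lt1 : half < 1. Proof. by rewrite invf_lt1 ?ltr1n. Qed.

Lemma decimal_bounds b : 0 <= decimal b <= 2.
Proof.
have /andP[h1 h2] := digit_series_bounds e10_ge0 e10_lt1 (fun i => bool01 (b i)).
apply/andP; split => //; apply: le_trans h2 _.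
by rewrite (_ : (1 - e10)^-1 = 10 / 9); [lra|field].
Qed.

Lemma decimalS b : decimal b = (b 0%N)%:R + e10 * decimal (fun i => b i.+1).
Proof. exact: digit_seriesS (fun i => bool01 (b i)). Qed.

Lemma zigzag_decimal b m : zigzag (10 ^+ m * decimal b) = (b m)%:R.
Proof.
have [k ->] : exists k, 10 ^+ m * decimal b = (2 * k)%:R + decimal (fun i => b (m + i)%N).
  elim: m => [|m [k IHk]]; first by exists 0%N; rewrite expr0 mul1r muln0 add0r.
  (* Multiplying [2 k + b m + tail / 10] by 10 gives [2 (10 k + 5 b m) + tail]; the integer part
     stays even because 10 is. *)
  exists (10 * k + 5 * b m)%N; rewrite exprS -mulrA {}IHk [in LHS]decimalS addn0.
  rewrite (_ : (fun i => b (m + i.+1)%N) = (fun i => b (m.+1 + i)%N)); last first.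
    by apply/funext => i; rewrite addnS.
  by rewrite !natrM natrD !natrM; field.
rewrite decimalS addn0 zigzag_digit//.
(* The remaining tail is at most [2 / 10], below the [1 / 4] allowed by [zigzag_digit]. *)
have /andP[h1 h2] := decimal_bounds (fun i => b (m + i.+1)%N).
by apply/andP; split; lra.
Qed.

(** The doubling map. It fixes 1, whose digits are then all 1, so the closed interval [[0, 1]] is
    preserved. *)
Definition bin_tail (x : R) : R := 2 * x - (2^-1 <= x)%R%:R.

Definition bin_digit (i : nat) (x : R) : bool := 2^-1 <= iter i bin_tail x.

(** The error [D] of the expansion satisfies [D y = D (bin_tail y) / 2] and is bounded by 1 on
    [[0, 1]], hence by [2^-n] for every [n]. *)
Lemma bin_digit_series (x : R) : 0 <= x <= 1 ->
  half * digit_series half (fun i => (bin_digit i x)%:R) = x.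
Proof.
move=> x01.
pose D (y : R) := y - half * digit_series half (fun i => (bin_digit i y)%:R).
have DS y : D y = half * D (bin_tail y).
  rewrite /D digit_seriesS//; last by move=> i; exact: bool01.
  rewrite (_ : (fun i => (bin_digit i.+1 y)%:R) = (fun i => (bin_digit i (bin_tail y))%:R)).
    by move: (digit_series _ _) => S; rewrite /bin_tail /bin_digit/=; field.
  by apply/funext => i; rewrite /bin_digit iterSr.
have tail01 y : 0 <= y <= 1 -> 0 <= bin_tail y <= 1.
  by move=> /andP[y0 y1]; rewrite /bin_tail; case: (leP 2^-1 y) => /= y2; apply/andP; split; lra.
have D1 y : 0 <= y <= 1 -> `|D y| <= 1.
  move=> /andP[y0 y1].
  have /andP[h1 h2] := digit_series_bounds half_ge0 half_lt1 (fun i => bool01 (bin_digit i y)).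
  have e2 : (1 - half)^-1 = 2 by field.
  by rewrite e2 in h2; rewrite ler_norml /D; apply/andP; split; lra.
have Dn n y : 0 <= y <= 1 -> `|D y| <= half ^+ n.
  elim: n y => [|n IHn] y y01; first by rewrite expr0; exact: D1.
  rewrite DS normrM (ger0_norm half_ge0) exprS ler_wpM2l//.
  by apply: IHn; exact: tail01.
suff : `|D x| <= 0 by rewrite normr_le0 subr_eq0 => /eqP <-.
have half_cvg : half ^+ n @[n --> \oo] --> (0 : R) by apply: cvg_expr; rewrite ger0_norm.
rewrite -(cvg_lim _ half_cvg)//; apply: limr_ge; first exact: cvgP half_cvg.
by apply: nearW => n; exact: Dn.
Qed.

Lemma measurable_bin_digit i : measurable_fun setT (fun x => (bin_digit i x)%:R : R).
Proof.
have mge : measurable_fun setT (fun x : R => (2^-1 <= x)%R%:R : R).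
  rewrite (_ : (fun _ => _) = \1_(`[2^-1, +oo[%classic : set R)).
    exact: measurable_indic.
  by apply/funext => x; rewrite indicE mem_setE in_itv/= andbT.
have mtail : measurable_fun setT bin_tail by apply: measurable_funB.
have miter : measurable_fun setT (iter i bin_tail).
  by elim: i => [|i IHi] /=; [exact: measurable_id|exact: measurableT_comp].
exact: (measurableT_comp mge miter).
Qed.

Section curve.
Variables (n : nat) (K : R).
Hypothesis K0 : 0 < K.

(** Schoenberg's space-filling curve, here filling the cube of radius [K]; the
    pairing function [pickle] distributes the digits among the coordinates. *)
Definition curve (t : R) : 'cV[R]_n :=
  \col_j (K * (digit_series half
    (fun i => zigzag (10 ^+ (pickle ((j, i) : 'I_n * nat)) * t)) - 1)).

(** The affine map takes [[-K, K]] to [[0, 1]]. Codes that decode to nothing get digit 0; the curve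
    reads only positions of the form [pickle (j, i)]. *)
Definition address_digit (x : 'cV[R]_n) (m : nat) : bool :=
  if (unpickle m : option ('I_n * nat)) is Some (j, i)
  then bin_digit i ((x j 0 / K + 1) / 2) else false.

Definition address (x : 'cV[R]_n) : R := decimal (address_digit x).

(** At the address of [x], the term [zigzag (10^(pickle (j, i)) t)] reads exactly the [i]-th binary
    digit of the rescaled [j]-th coordinate. *)
Lemma curve_address (x : 'cV[R]_n) : (forall j, `|x j 0| <= K) -> curve (address x) = x.
Proof.
move=> xK; apply/matrixP => j l; rewrite (ord1 l) mxE.
have -> : (fun i => zigzag (10 ^+ pickle (j, i) * address x)) =
    (fun i => (bin_digit i ((x j 0 / K + 1) / 2))%:R).
  by apply/funext => i; rewrite zigzag_decimal /address_digit pickleK.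
have /bin_digit_series : 0 <= (x j 0 / K + 1) / 2 <= 1.
  have := xK j; rewrite ler_norml => /andP[x1 x2].
  have h1 : -1 <= x j 0 / K by rewrite ler_pdivlMr// mulN1r.
  have h2 : x j 0 / K <= 1 by rewrite ler_pdivrMr// mul1r.
  by apply/andP; split; lra.
set d := digit_series _ _ => hd.
have -> : d = x j 0 / K + 1 by lra.
by field; rewrite gt_eqF.
Qed.

Lemma curve_continuous j : continuous (fun t => curve t j 0).
Proof.
have cf i : continuous (fun t : R => zigzag (10 ^+ (pickle ((j, i) : 'I_n * nat)) * t)).
  move: (10 ^+ _) => c t.
  apply: (@continuous_cvg _ _ _ _ _ (fun t => c * t) zigzag).
    exact: zigzag_continuous.
  exact: mulrl_continuous.
have cd := digit_series_continuous half_ge0 half_lt1 cf (fun i t => clamp01_bounds _).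
rewrite (_ : (fun t => _) = (fun t => K * (digit_series half
    (fun i => zigzag (10 ^+ (pickle ((j, i) : 'I_n * nat)) * t)) - 1))).
  by move=> t; apply: cvgM; [exact: cvg_cst|apply: cvgB; [exact: cd|exact: cvg_cst]].
by apply/funext => t; rewrite mxE.
Qed.

Lemma address_bounds (x : 'cV[R]_n) : 0 <= address x <= 2.
Proof. exact: decimal_bounds. Qed.

(** Binary digits jump, so the address is not continuous; it is Borel as a pointwise limit of its
    partial sums. *)
Lemma measurable_address : measurable_fun setT address.
Proof.
apply: (@measurable_fun_cvg _ _ _ _
  (fun N x => series (fun i => (address_digit x i)%:R * e10 ^+ i) N)).
  move=> N; apply: measurable_sum => i; apply: measurable_funM => //.
  rewrite /address_digit; case: unpickle => [[j l]|]; last exact: measurable_cst.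
  apply: (measurableT_comp (measurable_bin_digit l)).
  apply: measurable_funM => //; apply: measurable_funD => //.
  by apply: measurable_funM => //; exact: measurable_entry.
by move=> x _; apply: digit_series_cvg => // i; exact: bool01.
Qed.

End curve.

End schoenberg.

(** * Helly's selection theorem and quantile functions *)

Section helly.
Context {R : realType}.

Lemma rat_between (a b : R) : a < b -> exists q : rat, a < ratr q < b.
Proof.
move=> ab; have [||x [/=]] := @dense_rat R `]a, b[%classic.
- by exists ((a + b) / 2); rewrite /= in_itv/=; apply/andP; split; lra.
- exact: interval_open.
by rewrite in_itv/= => xab [q _ qx]; exists q; rewrite qx.
Qed.

(** Tychonoff's theorem on the countable set of rationals replaces the diagonal argument. The
    indices [phi n] need not increase strictly: [n <= phi n] is what limits along the selection
    require. *)
Lemma helly_selection (f : nat -> R -> R) (C : R) :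
  (forall k, {homo f k : u v / u <= v}) -> (forall k u, 0 <= f k u <= C) ->
  exists phi : nat -> nat, (forall n, (n <= phi n)%N) /\
    exists2 g : R -> R, {homo g : u v / u <= v} &
      {ae lebesgue_measure, forall u, f (phi n) u @[n --> \oo] --> g u}.
Proof.
move=> fm fC.
pose T := prod_topology (fun _ : rat => R).
pose r (k : nat) : T := fun q => f k (ratr q).
have cK : compact [set h : T | forall q, `[0, C]%classic (h q)].
  apply: (@tychonoff rat (fun=> R) (fun=> `[0, C]%classic)) => q; exact: segment_compact.
have rF : ProperFilter (r @ \oo) by exact: fmap_proper_filter.
have rK : (r @ \oo) [set h : T | forall q, `[0, C]%classic (h q)].
  by exists 0%N => // k _ q /=; rewrite in_itv/=; exact: fC.
have [c [Kc clc]] := cK _ rF rK.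
have hphi n : exists k, (n <= k)%N /\
    (forall q : rat, (pickle q < n)%N -> `|f k (ratr q) - c q| < n.+1%:R^-1).
  pose e : R := n.+1%:R^-1; have e0 : 0 < e by rewrite invr_gt0.
  (* Product neighbourhoods of [c] that control the rationals of code below [m]; a cluster point
     meets each of them at arbitrarily late indices. *)
  pose V m := [set h : T | forall q : rat, (pickle q < m)%N -> `|h q - c q| < e].
  have nV m : nbhs c (V m).
    elim: m => [|m IHm]; first by apply: (filterS _ filterT).
    case uE : (unpickle m : option rat) => [q|]; last first.
      apply: filterS IHm => h Vh p; rewrite ltnS leq_eqVlt => /orP[/eqP pm|]; last exact: Vh.
      by move: uE; rewrite -pm pickleK.
    have : (h : T) q @[h --> c] --> (c q : R) by exact: (@proj_continuous rat (fun=> R) q c).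
    move/cvgrPdist_lt => /(_ e e0) hq; apply: filterS2 IHm hq => h Vh hq p.
    rewrite ltnS leq_eqVlt => /orP[/eqP pm|]; last exact: Vh.
    by move: uE; rewrite -pm pickleK => -[->]; rewrite distrC.
  have [|h [[k nk <-] Vh]] := clc [set r k | k in [set k | (n <= k)%N]] (V n) _ (nV n).
    by exists n => // k /= nk; exists k.
  by exists k.
have [phi hp] := choice hphi.
have cq q : f (phi n) (ratr q) @[n --> \oo] --> c q.
  apply/cvgrPdist_lt => e e0.
  have [N _ hN] := near_infty_natSinv_lt (PosNum e0).
  exists (maxn N (pickle q).+1) => // n /=; rewrite geq_max => /andP[Nn qn].
  rewrite distrC; apply: lt_trans (hN _ Nn).
  exact: (hp n).2.
have c_homo p q : (p <= q)%R -> c p <= c q.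
  move=> pq; rewrite -(cvg_lim _ (cq p))// -(cvg_lim _ (cq q))//.
  apply: ler_lim; [exact: cvgP (cq p)|exact: cvgP (cq q)|].
  by apply: nearW => n; apply: fm; rewrite ler_rat.
have c0 q : 0 <= c q by have := Kc q; rewrite /= in_itv/= => /andP[].
exists phi; split=> [n|]; first exact: (hp n).1.
(* The limit function is the right limit of [c], which makes it monotone on all reals. *)
pose A (u : R) := [set x : R | exists2 q : rat, u < ratr q & c q = x].
have hinfA u : has_inf (A u).
  split; last by exists 0 => _ [q _ <-].
  by have [|q /andP[uq _]] := @rat_between u (u + 1); [rewrite ltrDl|exists (c q); exists q].
pose g (u : R) : R := inf (A u).
have g_homo : {homo g : u v / u <= v}.
  move=> u v uv; apply: lb_le_inf; first exact: (hinfA v).1.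
  by move=> _ [q /= vq <-]; apply: ge_inf; [exact: (hinfA u).2|exists q => //=; exact: le_lt_trans vq].
exists g => //.
(* The limit can fail only where [c] jumps over some rational level [s], and by
   monotonicity each level is jumped over at most once. *)
pose E (s : R) := [set u : R | forall q : rat,
  (ratr q < u -> c q < s) /\ (u < ratr q -> s < c q)].
have Ecount s : countable (E s).
  have [[u Eu]|E0] := pselect (exists u, E s u); last first.
    rewrite (_ : E s = set0)//; apply/seteqP; split => // u Eu; case: E0; by exists u.
  rewrite (_ : E s = [set u])//; apply/seteqP; split => [v Ev|_ ->//].
  apply/eqP; rewrite /= eq_le !leNgt; apply/andP; split; apply/negP => /rat_between[q /andP[q1 q2]].
    by have := lt_trans ((Eu q).2 q1) ((Ev q).1 q2); rewrite ltxx.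
  by have := lt_trans ((Ev q).2 q1) ((Eu q).1 q2); rewrite ltxx.
pose N := \bigcup_(s : rat) E (ratr s).
have Nc : countable N by apply: bigcup_countable => //; exact: countableP.
exists N; split.
- apply: countable_measurable => // t; exact: measurable_set1.
- exact: countable_lebesgue_measure0.
move=> u /=; apply: contra_notP => Nu; apply/cvgrPdist_lt => e e0.
have e2 : 0 < e / 2 by rewrite divr_gt0.
(* Otherwise [c] would jump at [u] over any rational level between [g u - e / 2] and [g u]. With a
   rational on each side of [u], monotonicity of [f (phi n)] then squeezes its value at [u]. *)
have [q [qu qg]] : exists q : rat, ratr q < u /\ g u - e / 2 < c q.
  apply: contrapT => hq; apply: Nu.
  have [|s /andP[s1 s2]] := @rat_between (g u - e / 2) (g u); first by rewrite ltrBlDr ltrDl.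
  exists s => // q; split => qu.
    by apply: le_lt_trans s1; rewrite leNgt; apply/negP => h; apply: hq; exists q.
  by apply: lt_le_trans s2 _; apply: ge_inf; [exact: (hinfA u).2|exists q].
have [_ [q' /= uq' <-] q'g] := inf_adherent e2 (hinfA u).
have /cvgrPdist_lt/(_ _ e2) h1 := cq q; have /cvgrPdist_lt/(_ _ e2) h2 := cq q'.
near=> n.
have d1 : `|c q - f (phi n) (ratr q)| < e / 2 by near: n.
have d2 : `|c q' - f (phi n) (ratr q')| < e / 2 by near: n.
have m1 := fm (phi n) _ _ (ltW qu); have m2 := fm (phi n) _ _ (ltW uq').
move: d1 d2; rewrite -/(g u) in q'g; rewrite !ltr_norml => /andP[a1 a2] /andP[b1 b2].
by apply/andP; split; lra.
Unshelve. all: by end_near. Qed.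

End helly.

Lemma probability_eq_cdf (R : realType) (P1 P2 : probability (measurableTypeR R) R) :
  (forall t, P1 `]-oo, t]%classic = P2 `]-oo, t]%classic) ->
  forall A, measurable A -> P1 A = P2 A.
Proof.
move=> P12 A mA.
rewrite -(lebesgue_stieltjes_cdf_id P1 mA); apply: lebesgue_stieltjes_measure_unique => //.
move=> X oX; rewrite lebesgue_stieltjes_cdf_id; last exact: sub_sigma_algebra.
case: oX => -[a b] _ <- /=.
have -> : `]a, b]%classic = `]-oo, b] `\` `]-oo, a] :> set R.
  by rewrite -[RHS]setCK setCD setCitvl setUC -[LHS]setCK setCitv.
have E (P : probability (measurableTypeR R) R) : (P (`]-oo, b] `\` `]-oo, a]) =
    P `]-oo, b]%classic - P (`]-oo, b]%classic `&` `]-oo, a]%classic))%E.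
  by rewrite measureD// -ge0_fin_numE// fin_num_measure.
rewrite !E P12; congr (_ - _)%E; have [ab|ba] := leP a b.
  by rewrite setIidr; [exact: P12|exact: subset_itvl].
by rewrite setIidl; [exact: P12|apply: subset_itvl; rewrite bnd_simp ltW].
Qed.

Section quantile.
Context d (T : measurableType d) (R : realType) (F : probability T R).
Variables (s : {RV F >-> R}) (C : R).
Hypothesis C0 : 0 <= C.
Hypothesis sC : forall x, 0 <= s x <= C.
Local Notation U := (uniform_prob (@ltr01 R)).

Let G t := fine (cdf s t).

Let GE t : (G t)%:E = cdf s t.
Proof. by rewrite fineK// fin_num_measure. Qed.

Let G_homo t t' : t <= t' -> G t <= G t'.
Proof. by move=> tt'; rewrite -lee_fin !GE; exact: cdf_nondecreasing. Qed.

Let G_ge0 t : 0 <= G t. Proof. by rewrite -lee_fin GE. Qed.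

Let G_le1 t : G t <= 1. Proof. by rewrite -lee_fin GE; exact: cdf_le1. Qed.

Let G_lt0 t : t < 0 -> G t = 0.
Proof.
move=> t0; rewrite /G /cdf /distribution /pushforward (_ : s @^-1` _ = set0) ?measure0//.
apply/seteqP; split => // x /=; rewrite in_itv/= => st.
by have /andP[] := sC x; rewrite leNgt (le_lt_trans st t0).
Qed.

Let G_ge t : C <= t -> G t = 1.
Proof.
move=> tC; rewrite /G /cdf /distribution /pushforward (_ : s @^-1` _ = setT) ?probability_setT//.
apply/seteqP; split => // x _ /=; rewrite in_itv/=.
by have /andP[_ sx] := sC x; exact: le_trans tC.
Qed.

(** The clause [C <= t] keeps the set nonempty for every real [u], also above 1, so the function is
    monotone and bounded on the whole line, as [helly_selection] asks. *)
Definition quantile (u : R) : R := inf [set t | 0 <= t /\ (C <= t \/ u <= G t)].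

Let quantile_has_inf u : has_inf [set t | 0 <= t /\ (C <= t \/ u <= G t)].
Proof. by split; [exists C; split => //; left|exists 0 => t []]. Qed.

Lemma quantile_homo : {homo quantile : u v / u <= v}.
Proof.
move=> u v uv; apply: lb_le_inf; first exact: (quantile_has_inf v).1.
move=> t [t0 ht]; apply: ge_inf; first exact: (quantile_has_inf u).2.
by split => //; case: ht => [|vt]; [left|right; exact: le_trans vt].
Qed.

Lemma quantile_bounds u : 0 <= quantile u <= C.
Proof.
apply/andP; split; first by apply: lb_le_inf; [exact: (quantile_has_inf u).1|move=> t []].
by apply: ge_inf; [exact: (quantile_has_inf u).2|split => //; left].
Qed.

(** The infimum is attained because the distribution function is right-continuous. At [u = 0] the
    equivalence fails for [t < 0], where [G t = 0] but the quantile is not below 0. *)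
Lemma quantile_le u t : 0 < u <= 1 -> (quantile u <= t) = (u <= G t).
Proof.
move=> /andP[u0 u1]; apply/idP/idP => [qt|ut]; last first.
  have t0 : 0 <= t by rewrite leNgt; apply/negP => /G_lt0 Gt; move: ut; rewrite Gt leNgt u0.
  by apply: ge_inf; [exact: (quantile_has_inf u).2|split => //; right].
have above t' : t < t' -> u <= G t'.
  move=> tt'; have e0 : 0 < t' - t by rewrite subr_gt0.
  have [x [x0 hx] xt] := inf_adherent e0 (quantile_has_inf u).
  have xt' : x <= t'.
    apply: ltW; apply: lt_le_trans xt _; rewrite -lerBrDr opprB addrCA subrr addr0.
    exact: qt.
  case: hx => [Cx|ux]; first by rewrite (G_ge (le_trans Cx xt')).
  exact: le_trans ux (G_homo xt').
rewrite -lee_fin GE.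
have rc := @cdf_right_continuous _ _ _ F s t.
rewrite -(cvg_lim _ rc)//; apply: lime_ge; first exact: cvgP rc.
near=> t'; rewrite -GE lee_fin; apply: above; near: t'; exact: nbhs_right_gt.
Unshelve. all: by end_near. Qed.

Lemma measurable_quantile :
  measurable_fun setT (quantile : measurableTypeR R -> measurableTypeR R).
Proof. by apply: nondecreasing_measurable => //; exact: quantile_homo. Qed.

Lemma uniform_quantile_cdf t : U (quantile @^-1` `]-oo, t]%classic) = (G t)%:E.
Proof.
rewrite /uniform_prob integral_uniform_pdf.
have [t0|t0] := ltP t 0.
  rewrite (_ : _ `&` _ = set0) ?integral_set0 ?G_lt0//.
  apply/seteqP; split => // u [/=]; rewrite in_itv/= => qt _.
  by have /andP[] := quantile_bounds u; rewrite leNgt (le_lt_trans qt t0).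
rewrite (_ : _ `&` _ = `[0, G t]%classic).
  rewrite (eq_integral (cst 1%E)); last first.
    move=> u; rewrite inE/= in_itv/= => /andP[u0 uG].
    by rewrite /uniform_pdf u0 (le_trans uG (G_le1 t))/= subr0 invr1.
  rewrite integral_cst//= mul1e lebesgue_measure_itv/= lte_fin sube0.
  by case: ltP => // G0; congr EFin; apply/eqP; rewrite eq_le G_ge0.
apply/seteqP; split => u /=; rewrite !in_itv/=.
  move=> [qt /andP[u0 u1]]; rewrite u0/=.
  (* The endpoint [u = 0], outside the scope of [quantile_le], is settled directly. *)
  move: u0; rewrite le_eqVlt => /orP[/eqP <-|u0]; first exact: G_ge0.
  by rewrite -quantile_le// u0.
move=> /andP[u0 uG]; have u1 := le_trans uG (G_le1 t).
rewrite u0 u1; split => //.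
move: u0; rewrite le_eqVlt => /orP[/eqP <-|u0]; last by rewrite quantile_le// u0.
apply: le_trans t0; apply: ge_inf; first exact: (quantile_has_inf 0).2.
by split => //; right; exact: G_ge0.
Qed.

(** Inverse transform sampling: both laws on the line have the same distribution function. *)
Lemma quantile_law (A : set R) : measurable A ->
  U (quantile @^-1` A) = F (s @^-1` A).
Proof.
move=> mA.
pose mixin := isMeasurableFun.Build _ _ _ _ (quantile : measurableTypeR R -> measurableTypeR R)
  measurable_quantile.
pose q : {mfun measurableTypeR R >-> measurableTypeR R} :=
  HB.pack (quantile : measurableTypeR R -> measurableTypeR R) mixin.
pose P1 : probability (measurableTypeR R) R := distribution U q.
have ms : measurable_fun setT (s : T -> measurableTypeR R) by exact: (measurable_funP s).
pose mixin2 := isMeasurableFun.Build _ _ _ _ (s : T -> measurableTypeR R) ms.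
pose s2 : {mfun T >-> measurableTypeR R} := HB.pack (s : T -> measurableTypeR R) mixin2.
pose P2 : probability (measurableTypeR R) R := distribution F s2.
apply: (@probability_eq_cdf R P1 P2) => // t.
by rewrite [LHS]uniform_quantile_cdf GE.
Qed.

End quantile.

(** * Borel sets of matrices and attained maxima *)

Section matrix_borel.
Context {R : realType} (m n : nat).

(** An open set is the union of the boxes it contains with rational centres and radii [1 / (k + 1)];
    there are countably many, and each is given by finitely many conditions on entries. *)
Lemma open_measurable_mx (A : set 'M[R]_(m, n)) : open A -> measurable A.
Proof.
move=> oA.
pose B (p : 'M[rat]_(m, n) * nat) : set 'M[R]_(m, n) :=
  [set y | forall ij : 'I_m * 'I_n, `|ratr (p.1 ij.1 ij.2) - y ij.1 ij.2| < p.2.+1%:R^-1].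
have mB p : measurable (B p).
  have -> : B p = \bigcap_(ij in [set: 'I_m * 'I_n])
      [set y | `|ratr (p.1 ij.1 ij.2) - y ij.1 ij.2| < p.2.+1%:R^-1].
    by apply/seteqP; split => x /= h ij; [move=> _|]; exact: h.
  apply: fin_bigcap_measurable => // ij _.
  have mf : measurable_fun setT
      (fun y : 'M[R]_(m, n) => `|ratr (p.1 ij.1 ij.2) - y ij.1 ij.2|).
    apply: measurableT_comp => //; apply: measurable_funB => //.
    exact: measurable_entry.
  rewrite -[X in measurable X]setTI.
  have := mf measurableT _ (measurable_itv `]-oo, (p.2.+1%:R^-1)[).
  by congr measurable; apply/seteqP; split => x /=; rewrite in_itv.
have -> : A = \bigcup_(p in [set p | B p `<=` A]) B p.
  apply/seteqP; split => [x Ax|x [p /= pA]]; last exact: pA.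
  have := oA; rewrite openE => /(_ x Ax) /nbhs_ballP[e /= e0 eA].
  have e2 : 0 < e / 2 by rewrite divr_gt0.
  have [N _ hN] := near_infty_natSinv_lt (PosNum e2).
  pose d : R := N.+1%:R^-1; have d0 : 0 < d by rewrite invr_gt0.
  have hd : d < e / 2 by exact: (hN N (leqnn N)).
  have hq (i : 'I_m) (j : 'I_n) : exists q : rat, `|ratr q - x i j| < d.
    have [||y [/=]] := @dense_rat R `](x i j - d), (x i j + d)[%classic.
    - by exists (x i j); rewrite /= in_itv/=; apply/andP; split; lra.
    - exact: interval_open.
    rewrite in_itv/= => /andP[y1 y2] [q _ qy]; exists q; rewrite qy ltr_norml.
    by apply/andP; split; lra.
  have [q hq'] := choice (fun ij : 'I_m * 'I_n => hq ij.1 ij.2).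
  exists (\matrix_(i, j) q (i, j), N); last by move=> -[i j] /=; rewrite mxE; exact: (hq' (i, j)).
  move=> y By; apply: eA; split => // i j.
  have := By (i, j); rewrite /= mxE => h1; have := hq' (i, j); rewrite /= => h2.
  rewrite /ball/= -[x i j](subrK (ratr (q (i, j)))) -addrA.
  apply: le_lt_trans (ler_normD _ _) _; rewrite distrC.
  by apply: lt_trans (ltrD h2 h1) _; rewrite -/d; lra.
rewrite bigcup_mkcond; apply: countable_bigcupT_measurable; first exact: countableP.
by move=> p; case: ifP.
Qed.

Lemma closed_measurable_mx (A : set 'M[R]_(m, n)) : closed A -> measurable A.
Proof.
move=> cA; rewrite -[A]setCK; apply: measurableC; apply: open_measurable_mx.
exact: closed_openC.
Qed.

Lemma cvg_mx_entries (f : nat -> 'M[R]_(m, n)) (l : 'M[R]_(m, n)) :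
  (forall i j, f k i j @[k --> \oo] --> l i j) -> f @ \oo --> l.
Proof.
move=> fl; apply/cvg_ballP => e e0.
suff : \forall k \near \oo, forall ij : 'I_m * 'I_n, `|l ij.1 ij.2 - f k ij.1 ij.2| < e.
  by apply: filterS => k h; split => // i j; exact: (h (i, j)).
apply: filter_forall => -[i j] /=.
by have /cvgrPdist_lt/(_ _ e0) := fl i j.
Qed.

Lemma compact_entry_bound (X : set 'M[R]_(m, n)) : compact X ->
  exists2 K : R, 0 < K & forall x, X x -> forall i j, `|x i j| <= K.
Proof.
move=> cX.
have hK (ij : 'I_m * 'I_n) : exists K : R, forall x, X x -> `|x ij.1 ij.2| <= K.
  have cf : {within X, continuous (fun x : 'M[R]_(m, n) => x ij.1 ij.2)}.
    by apply: continuous_subspaceT => x; exact: coord_continuous.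
  have /compact_bounded[M [_ hM]] := continuous_compact cf cX.
  exists (M + 1) => x Xx; apply: (hM (M + 1)); first by rewrite ltrDl.
  by exists x.
have [K hK'] := choice hK.
(* The summand 1 makes the radius positive, since [curve_address] divides by it. *)
exists (1 + \sum_ij `|K ij|); first by rewrite ltr_pwDl// sumr_ge0.
move=> x Xx i j; apply: le_trans (hK' (i, j) x Xx) _.
apply: le_trans (ler_norm _) _.
by rewrite (bigD1 (i, j))//= addrCA lerDl addr_ge0// sumr_ge0.
Qed.

End matrix_borel.

(** Sequential compactness is stated through [J] alone, so the set of laws carries no topology. *)
Lemma attained_max (R : realType) (T : Type) (L : set T) (J : T -> R) :
  L !=set0 ->
  (forall x_ : nat -> T, (forall k, L (x_ k)) -> exists phi : nat -> nat,
    (forall n, (n <= phi n)%N) /\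
    exists2 x, L x & J (x_ (phi n)) @[n --> \oo] --> J x) ->
  exists2 x, L x & forall y, L y -> J y <= J x.
Proof.
move=> [x0 Lx0] sub.
(* If [J] were unbounded, pick [x_ k] with [J (x_ k) > k]; then [J (x_ (phi n)) > n] contradicts
   convergence. *)
have ubS : has_ubound [set J x | x in L].
  apply: contrapT => nub.
  have hk (k : nat) : exists x, L x /\ k%:R < J x.
    apply: contrapT => h; apply: nub; exists k%:R => _ [x Lx <-].
    by rewrite leNgt; apply/negP => kJ; apply: h; exists x.
  have [x_ hx_] := choice hk.
  have [phi [phin [x Lx /cvgrPdist_lt/(_ 1 ltr01) cJ]]] := sub x_ (fun k => (hx_ k).1).
  near \oo => N.
  have h1 : `|J x - J (x_ (phi N))| < 1 by near: N.
  have h2 : J x + 1 <= N%:R by near: N; exact: nbhs_infty_ger.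
  have h3 := (hx_ (phi N)).2.
  have h4 : N%:R <= (phi N)%:R :> R by rewrite ler_nat.
  by move: h1; rewrite ltr_norml => /andP[h5 h6]; lra.
have supS : has_sup [set J x | x in L] by split => //; exists (J x0); exists x0.
pose S := sup [set J x | x in L].
have hk (k : nat) : exists x, L x /\ S - k.+1%:R^-1 < J x.
  have k0 : 0 < k.+1%:R^-1 :> R by rewrite invr_gt0.
  by have [_ [x Lx <-] h] := sup_adherent k0 supS; exists x.
have [x_ hx_] := choice hk.
have [phi [phin [x Lx cJ]]] := sub x_ (fun k => (hx_ k).1).
exists x => // y Ly; apply: (@le_trans _ _ S); first by apply: ub_le_sup => //; exists y.
rewrite leNgt; apply/negP => JS.
have e0 : 0 < (S - J x) / 2 by rewrite divr_gt0// subr_gt0.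
have /cvgrPdist_lt/(_ _ e0) c1 := cJ.
near \oo => N.
have h1 : `|J x - J (x_ (phi N))| < (S - J x) / 2 by near: N.
have h2 : N.+1%:R^-1 < (S - J x) / 2 by near: N; exact: (near_infty_natSinv_lt (PosNum e0)).
have h3 := (hx_ (phi N)).2.
have h4 : (phi N).+1%:R^-1 <= N.+1%:R^-1 :> R by rewrite lef_pV2 ?posrE// ler_nat ltnS.
have h7 : S - (S - J x) / 2 < J (x_ (phi N)).
  by apply: lt_trans h3; rewrite ltrD2l ltrN2; exact: le_lt_trans h4 h2.
have aux (s j v : R) : s - (s - j) / 2 < v -> - ((s - j) / 2) < j - v -> False by lra.
by move: h1; rewrite ltr_norml => /andP[h5 _]; exact: aux h7 h5.
Unshelve. all: by end_near. Qed.

(** * Continuity of the overlap and of the information *)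

Section law_transfer.
Context d1 d2 (T1 : measurableType d1) (T2 : measurableType d2) (R : realType).
Variables (mu : {measure set T1 -> \bar R}) (nu : {measure set T2 -> \bar R}) (xi : T1 -> T2).
Hypothesis mxi : measurable_fun setT xi.
Hypothesis law : forall A, measurable A -> nu A = mu (xi @^-1` A).
Local Open Scope ereal_scope.

Lemma ge0_integral_law (f : T2 -> \bar R) : measurable_fun setT f ->
  (forall x, 0 <= f x) -> \int[nu]_x f x = \int[mu]_u f (xi u).
Proof.
move=> mf f0.
pose mixin := isMeasurableFun.Build _ _ _ _ xi mxi.
pose x : {mfun T1 >-> T2} := HB.pack xi mixin.
rewrite (@eq_measure_integral _ _ _ _ (pushforward mu x)); last by move=> A mA _; exact: law.
by rewrite ge0_integral_pushforward.
Qed.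

Lemma integral_law (f : T2 -> \bar R) : measurable_fun setT f ->
  \int[nu]_x f x = \int[mu]_u f (xi u).
Proof.
move=> mf; rewrite [LHS]integralE [RHS]integralE.
congr (_ - _).
  rewrite ge0_integral_law//; last exact: measurable_funepos.
  by apply: eq_integral => u _; rewrite !funeposE.
rewrite ge0_integral_law//; last exact: measurable_funeneg.
by apply: eq_integral => u _; rewrite !funenegE.
Qed.

End law_transfer.

Lemma product_prob_law d1 d2 d3 (T1 : measurableType d1) (T2 : measurableType d2)
    (T3 : measurableType d3) (R : realType) (U : probability T1 R)
    (F : probability T2 R) (Q : probability T3 R) (xi : T1 -> T2) :
  measurable_fun setT xi ->
  (forall A, measurable A -> F A = U (xi @^-1` A)) ->
  forall A, measurable A ->
    product_prob F Q A = product_prob U Q ((fun w => (xi w.1, w.2)) @^-1` A).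
Proof.
move=> mxi law A mA.
rewrite /product_prob /product_measure1 /= (ge0_integral_law mxi law).
- apply: eq_integral => u _ /=; congr (Q _).
- exact: measurable_fun_xsection.
- by move=> x /=; exact: measure_ge0.
Qed.

Lemma cvg_sum_ord (R : realType) n (f : 'I_n -> R^nat) (l : 'I_n -> R) :
  (forall i, f i k @[k --> \oo] --> l i) ->
  \sum_i f i k @[k --> \oo] --> \sum_i l i.
Proof.
elim: n => [|n IHn] in f l * => fl.
  rewrite (_ : (fun k => _) = cst 0); last by apply/funext => k; rewrite big_ord0.
  by rewrite big_ord0; exact: cvg_cst.
rewrite (_ : (fun k => _) = (fun k => f ord0 k + \sum_i f (lift ord0 i) k)); last first.
  by apply/funext => k; rewrite big_ord_recl.
by rewrite big_ord_recl; apply: cvgD => //; exact: (IHn (fun i => f (lift ord0 i))).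
Qed.

Lemma cvgr_sqr (R : realType) (f : R^nat) (l : R) :
  f @ \oo --> l -> (fun k => f k ^+ 2) @ \oo --> l ^+ 2.
Proof.
move=> fl; rewrite expr2 (_ : (fun k => _) = (fun k => f k * f k)); first exact: cvgM.
by apply/funext => k; rewrite expr2.
Qed.

Section convergence.
Context d (Om : measurableType d) (R : realType) (U : probability Om R).
Context (nt nr : nat) (H : 'M[R]_(nr, nt)) (M : R).
Hypothesis M0 : 0 <= M.
Variables (F_ : nat -> probability 'cV[R]_nt R) (F : probability 'cV[R]_nt R).
Variables (xi_ : nat -> Om -> 'cV[R]_nt) (xi : Om -> 'cV[R]_nt).
Hypothesis mxi_ : forall k, measurable_fun setT (xi_ k).
Hypothesis mxi : measurable_fun setT xi.
Hypothesis law_ : forall k A, measurable A -> F_ k A = U (xi_ k @^-1` A).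
Hypothesis law : forall A, measurable A -> F A = U (xi @^-1` A).
Hypothesis xiM_ : forall k u, bounded_image H M (xi_ k u).
Hypothesis xiM : forall u, bounded_image H M (xi u).
Hypothesis xi_cvg : {ae U, forall u, forall i, xi_ k u i 0 @[k --> \oo] --> xi u i 0}.
Local Notation gamma := (@std_gaussian R nr).

Let image_law (G : probability 'cV[R]_nt R) (x : Om -> 'cV[R]_nt) :
  (forall A, measurable A -> G A = U (x @^-1` A)) ->
  (forall u, bounded_image H M (x u)) -> G (bounded_image H M) = 1%E.
Proof.
move=> lw xM; rewrite lw; last exact: measurable_bounded_image.
rewrite (_ : _ @^-1` _ = setT) ?probability_setT//.
by apply/seteqP; split => // u _; exact: xM.
Qed.

Let FM_ k : F_ k (bounded_image H M) = 1%E. Proof. exact: image_law (law_ k) (xiM_ k). Qed.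
Let FM : F (bounded_image H M) = 1%E. Proof. exact: image_law law xiM. Qed.

Let image_cvg u : (forall i, xi_ k u i 0 @[k --> \oo] --> xi u i 0) ->
  forall i, (H *m xi_ k u) i 0 @[k --> \oo] --> (H *m xi u) i 0.
Proof.
move=> xc i; rewrite mxE.
rewrite (_ : (fun k => _) = (fun k => \sum_j H i j * xi_ k u j 0)); last first.
  by apply/funext => k; rewrite mxE.
apply: (@cvg_sum_ord _ _ (fun j k => H i j * xi_ k u j 0)) => j; apply: cvgM; [exact: cvg_cst|exact: xc].
Qed.

Let measurable_kernel_comp (x : Om -> 'cV[R]_nt) : measurable_fun setT x ->
  measurable_fun setT (fun w : Om * Om => (pair_kernel H (x w.1, x w.2))%:E).
Proof.
move=> mx; apply/measurable_EFinP; apply: (measurableT_comp (measurable_pair_kernel H)).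
by apply: measurable_fun_pair; [exact: (measurableT_comp mx measurable_fst)|
  exact: (measurableT_comp mx measurable_snd)].
Qed.

Let overlap_law (G : probability 'cV[R]_nt R) (x : Om -> 'cV[R]_nt) :
  measurable_fun setT x -> (forall A, measurable A -> G A = U (x @^-1` A)) ->
  overlap H G = (\int[product_prob U U]_w (pair_kernel H (x w.1, x w.2))%:E)%E.
Proof.
move=> mx lw; rewrite overlapE.
have mk : measurable_fun setT (fun w => (pair_kernel H w)%:E).
  by apply/measurable_EFinP; exact: measurable_pair_kernel.
have k0 w : (0 <= (pair_kernel H w)%:E)%E by rewrite lee_fin expR_ge0.
rewrite [LHS](@fubini_tonelli1 _ _ _ _ _ G G _ mk k0).
rewrite (ge0_integral_law mx lw); last 2 first.
- exact: (measurable_fun_fubini_tonelli_F _ mk k0).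
- by move=> y; apply: integral_ge0.
rewrite [RHS](@fubini_tonelli1 _ _ _ _ _ U U _ (measurable_kernel_comp mx) (fun w => k0 (x w.1, x w.2))).
apply: eq_integral => u _; rewrite /fubini_F.
rewrite (ge0_integral_law mx lw)//.
exact: (measurableT_comp mk (pair1_measurable _)).
Qed.

Lemma overlap_cvg : overlap H (F_ k) @[k --> \oo] --> overlap H F.
Proof.
rewrite (overlap_law mxi law).
rewrite (_ : (fun k => _) =
    (fun k => \int[product_prob U U]_w (pair_kernel H (xi_ k w.1, xi_ k w.2))%:E)%E);
  last by apply/funext => k; rewrite (overlap_law (mxi_ k) (law_ k)).
have [] := @dominated_convergence _ _ _ (product_prob U U) setT measurableT
  (fun k w => (pair_kernel H (xi_ k w.1, xi_ k w.2))%:E)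
  (fun w => (pair_kernel H (xi w.1, xi w.2))%:E) (cst 1%E).
- by move=> k; exact: measurable_kernel_comp.
- exact: measurable_kernel_comp.
- have h1 := ae_product_fst U xi_cvg; have h2 := ae_product_snd U xi_cvg.
  apply: filterS2 h1 h2 => w w1 w2 _.
  apply/fine_cvgP; split; first exact: nearW.
  rewrite /= /pair_kernel.
  apply: (@continuous_cvg _ _ _ _ _ _ (@expR R)); first exact: continuous_expR.
  apply: cvgN; apply: (@cvg_sum_ord _ _ (fun i k =>
    ((H *m xi_ k w.1) i 0 - (H *m xi_ k w.2) i 0) ^+ 2 / 4)) => i; apply: cvgM; last exact: cvg_cst.
  have c1 := image_cvg w1 (i := i); have c2 := image_cvg w2 (i := i).
  by apply: (@cvgr_sqr _ (fun k => (H *m xi_ k w.1) i 0 - (H *m xi_ k w.2) i 0)); exact: cvgB.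
- exact: finite_measure_integrable_cst.
- apply: aeW => w k _; rewrite lee_fin ger0_norm ?expR_ge0// expR_le1 oppr_le0.
  by apply: sumr_ge0 => i _; rewrite divr_ge0// sqr_ge0.
by [].
Qed.

Let info (G : probability 'cV[R]_nt R) (x : Om -> 'cV[R]_nt) (w : Om * 'cV[R]_nr) : R :=
  info_density H G (x w.1, channel_output H (x w.1, w.2)).

Let measurable_info (G : probability 'cV[R]_nt R) (x : Om -> 'cV[R]_nt) :
  measurable_fun setT x -> measurable_fun setT (fun w => (info G x w)%:E).
Proof.
move=> mx; apply/measurable_EFinP; apply: (measurableT_comp (measurable_info_density H G)).
have mx1 : measurable_fun setT (fun w : Om * 'cV[R]_nr => x w.1).
  exact: (measurableT_comp mx measurable_fst).
apply: measurable_fun_pair => //; apply: (measurableT_comp (measurable_channel_output H)).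
by apply: measurable_fun_pair => //; exact: measurable_snd.
Qed.

Let info_law (G : probability 'cV[R]_nt R) (x : Om -> 'cV[R]_nt) :
  measurable_fun setT x -> (forall A, measurable A -> G A = U (x @^-1` A)) ->
  (\int[product_prob G gamma]_w (info_density H G (w.1, channel_output H w))%:E =
   \int[product_prob U gamma]_w (info G x w)%:E)%E.
Proof.
move=> mx lw.
have mp : measurable_fun setT (fun w : Om * 'cV[R]_nr => (x w.1, w.2)).
  apply: measurable_fun_pair; last exact: measurable_snd.
  exact: (measurableT_comp mx measurable_fst).
rewrite (integral_law mp (product_prob_law gamma mx lw))//.
apply/measurable_EFinP; apply: (measurableT_comp (measurable_info_density H G)).
by apply: measurable_fun_pair; [exact: measurable_fst|exact: measurable_channel_output].
Qed.

Let density_law (G : probability 'cV[R]_nt R) (x : Om -> 'cV[R]_nt) y :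
  measurable_fun setT x -> (forall A, measurable A -> G A = U (x @^-1` A)) ->
  (output_density H G y)%:E = (\int[U]_u (gaussian_shift (H *m x u) y)%:E)%E.
Proof.
move=> mx lw; rewrite output_densityE (ge0_integral_law mx lw)//.
- apply/measurable_EFinP; apply: measurable_gaussian_shift => //; exact: measurable_mulmx.
- by move=> a; rewrite lee_fin gaussian_shift_ge0.
Qed.

Let exponent_cvg (a_ b_ : nat -> 'cV[R]_nr) (a b : 'cV[R]_nr) :
  (forall i, a_ k i 0 @[k --> \oo] --> a i 0) -> (forall i, b_ k i 0 @[k --> \oo] --> b i 0) ->
  \sum_i (a_ k i 0 * b_ k i 0 - a_ k i 0 ^+ 2 / 2) @[k --> \oo] -->
  \sum_i (a i 0 * b i 0 - a i 0 ^+ 2 / 2).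
Proof.
move=> ca cb.
apply: (@cvg_sum_ord _ _ (fun i k => a_ k i 0 * b_ k i 0 - a_ k i 0 ^+ 2 / 2)) => i; apply: cvgB; first exact: cvgM.
by apply: cvgM; [exact: (@cvgr_sqr _ (fun k => a_ k i 0))|exact: cvg_cst].
Qed.

(** Law and evaluation point move together, because the output at fixed noise depends on the input.
    Bounded evaluation points make the dominating function constant. *)
Lemma output_density_cvg (z_ : nat -> 'cV[R]_nr) (z : 'cV[R]_nr) (K : R) :
  (forall i, z_ k i 0 @[k --> \oo] --> z i 0) -> (forall k i, `|z_ k i 0| <= K) ->
  output_density H (F_ k) (z_ k) @[k --> \oo] --> output_density H F z.
Proof.
move=> cz zK.
have mg (x : Om -> 'cV[R]_nt) y : measurable_fun setT x ->
    measurable_fun setT (fun u => (gaussian_shift (H *m x u) y)%:E).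
  move=> mx; apply/measurable_EFinP; apply: measurable_gaussian_shift => //.
  exact: (measurableT_comp (measurable_mulmx H) mx).
have [] := @dominated_convergence _ _ _ U setT measurableT
  (fun k u => (gaussian_shift (H *m xi_ k u) (z_ k))%:E)
  (fun u => (gaussian_shift (H *m xi u) z)%:E)
  (cst (expR (\sum_(i < nr) (M * K + M ^+ 2 / 2)))%:E).
- by move=> k; exact: mg.
- exact: mg.
- apply: filterS xi_cvg => u xu _.
  apply/fine_cvgP; split; first exact: nearW.
  apply: (@continuous_cvg _ _ _ _ _ _ (@expR R)); first exact: continuous_expR.
  by apply: exponent_cvg => //; exact: image_cvg.
- exact: finite_measure_integrable_cst.
- apply: aeW => u k _; rewrite lee_fin ger0_norm ?gaussian_shift_ge0//.
  have /andP[_] := gaussian_shift_bounds M0 (z_ k) (xiM_ k u).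
  move=> /le_trans; apply; rewrite ler_expR; apply: ler_sum => i _.
  by rewrite lerD2r ler_wpM2l.
move=> _ _; rewrite -(density_law z mxi law) => h.
suff : (output_density H (F_ k) (z_ k))%:E @[k --> \oo] --> (output_density H F z)%:E.
  by move/fine_cvgP => -[].
apply: cvg_trans h; apply: near_eq_cvg; apply: nearW => k /=.
by rewrite (density_law _ (mxi_ k) (law_ k)).
Qed.

(** Two nested limits: at fixed noise the output densities converge by [output_density_cvg], then
    [info_bound] dominates the logarithms. *)
Lemma channel_information_cvg :
  fine (channel_information H (F_ k)) @[k --> \oo] --> fine (channel_information H F).
Proof.
rewrite (channel_information_fine M0 FM)/=.
rewrite (_ : (fun k => _) = (fun k => fine (\int[product_prob (F_ k) gamma]_w
    (info_density H (F_ k) (w.1, channel_output H w))%:E)%E / ln 2)); last first.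
  by apply/funext => k; rewrite (channel_information_fine M0 (FM_ k)).
apply: cvgM; last exact: cvg_cst.
have fn := integrable_fin_num measurableT (integrable_info_density M0 FM).
apply: fine_cvg; rewrite fineK//.
rewrite (info_law mxi law).
rewrite (_ : (fun k => _) = (fun k => \int[product_prob U gamma]_w (info (F_ k) (xi_ k) w)%:E)%E);
  last by apply/funext => k; rewrite (info_law (mxi_ k) (law_ k)).
have [] := @dominated_convergence _ _ _ (product_prob U gamma) setT measurableT
  (fun k w => (info (F_ k) (xi_ k) w)%:E) (fun w => (info F xi w)%:E)
  (fun w => (info_bound M w.2)%:E).
- by move=> k; exact: measurable_info.
- exact: measurable_info.
- apply: filterS (ae_product_fst gamma xi_cvg) => -[u z] /= /image_cvg xu _.
  apply/fine_cvgP; split; first exact: nearW.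
  have cy i : (channel_output H (xi_ k u, z)) i 0 @[k --> \oo] --> (channel_output H (xi u, z)) i 0.
    rewrite /channel_output [X in _ --> X]mxE.
    rewrite (_ : (fun k => _) = (fun k => (H *m xi_ k u) i 0 + z i 0)).
      by apply: cvgD; [exact: xu|exact: cvg_cst].
    by apply/funext => k; rewrite mxE.
  rewrite /= /info /info_density/=; apply: cvgB.
    rewrite /gaussian_shift expRK (_ : (fun k => _) = (fun k => \sum_i
      ((H *m xi_ k u) i 0 * channel_output H (xi_ k u, z) i 0 - (H *m xi_ k u) i 0 ^+ 2 / 2))).
      exact: exponent_cvg.
    by apply/funext => k; rewrite expRK.
  apply: (@continuous_cvg _ _ _ _ _ _ (@ln R)).
    by apply: continuous_ln; exact: (output_density_gt0 M0 FM).
  (* At fixed noise [z] this constant bounds the entries of all outputs. *)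
  apply: (@output_density_cvg _ _ (M + \sum_i `|z i 0|)) => // k i.
  rewrite [X in `|X|]mxE; apply: le_trans (ler_normD _ _) _.
  apply: lerD; first exact: xiM_.
  by rewrite (bigD1 i)//= lerDl sumr_ge0.
- exact: (@integrable_product_snd _ _ _ _ R U gamma _ (@integrable_info_bound R nr M)).
- by apply: aeW => -[u z] k _; rewrite lee_fin; exact: info_density_le.
by [].
Qed.

End convergence.

(** * Sequential compactness of the input laws, and the theorem *)

Section probability_one.
Context d (T : measurableType d) (R : realType) (P : probability T R).

Lemma probability1_setC (X : set T) : measurable X -> P X = 1%E -> P (~` X) = 0%E.
Proof. by move=> mX PX; rewrite [LHS]probability_setC// PX subee. Qed.

Lemma probability_eq_on (X A B : set T) : measurable X -> P X = 1%E ->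
  measurable A -> measurable B -> A `&` X = B `&` X -> P A = P B.
Proof.
move=> mX PX mA mB AB.
have E (D : set T) : measurable D -> P D = P (D `&` X).
  move=> mD; have h : P (D `\` X) = 0%E.
    apply/eqP; rewrite eq_le measure_ge0 andbT -(probability1_setC mX PX).
    apply: le_measure; rewrite ?inE; [exact: measurableD|exact: measurableC|by move=> x []].
  by rewrite (measureDI P mD mX) [Y in (Y + _)%E]h add0e.
by rewrite (E A)// (E B)// AB.
Qed.

Lemma ae_probability1 (X : set T) : measurable X ->
  {ae P, forall x, X x} <-> P X = 1%E.
Proof.
move=> mX; split=> [[N [mN N0 sN]]|PX]; last first.
  by exists (~` X); split; [exact: measurableC|exact: probability1_setC|].
have PC : P (~` X) = 0%E.
  apply/eqP; rewrite eq_le measure_ge0 andbT -N0.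
  by apply: le_measure; rewrite ?inE; [exact: measurableC|exact: mN|exact: sN].
have := probability_setC P (measurableC mX); rewrite setCK => ->.
by rewrite PC sube0.
Qed.

Lemma probability1_sub (X A : set T) : measurable X -> measurable A -> X `<=` A ->
  P X = 1%E -> P A = 1%E.
Proof.
move=> mX mA XA /(ae_probability1 mX) aeX; apply/(ae_probability1 mA).
exact: filterS aeX.
Qed.

End probability_one.

Section input_compactness.
Context {R : realType} (nt nr : nat) (H : 'M[R]_(nr, nt)) (X : set 'cV[R]_nt).
Hypothesis cX : compact X.
Local Notation U := (uniform_prob (@ltr01 R)).

Definition image_radius (K : R) : R := K * \sum_i \sum_j `|H i j|.

Lemma image_radius_ge0 K : 0 <= K -> 0 <= image_radius K.
Proof. by move=> K0; rewrite mulr_ge0// sumr_ge0// => i _; rewrite sumr_ge0. Qed.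

Lemma cube_bounded_image K (x : 'cV[R]_nt) : 0 <= K -> (forall j, `|x j 0| <= K) ->
  bounded_image H (image_radius K) x.
Proof.
move=> K0 xK i; rewrite mxE; apply: le_trans (ler_norm_sum _ _ _) _.
apply: (@le_trans _ _ (\sum_j `|H i j| * K)).
  by apply: ler_sum => j _; rewrite normrM ler_wpM2l.
rewrite -mulr_suml mulrC ler_wpM2l// (bigD1 i)//= lerDl sumr_ge0// => k _.
by rewrite sumr_ge0.
Qed.

Lemma measurable_compact : measurable X.
Proof. by apply: closed_measurable_mx; apply: compact_closed => //; exact: norm_hausdorff. Qed.

(** The digit series of a clamped function stays in [[0, 2]] at every real [t], so the representing
    vectors are bounded everywhere, whatever values Helly's limit takes. *)
Lemma curve_bounds n (K : R) t j : 0 < K -> `|curve n K t j 0| <= K.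
Proof.
move=> K0; rewrite mxE.
have h0 : 0 <= 2^-1 :> R by rewrite invr_ge0.
have h1 : 2^-1 < 1 :> R by rewrite invf_lt1 ?ltr1n.
have /andP[s0] := digit_series_bounds h0 h1
  (fun i => clamp01_bounds (2^-1 - cos (pi * (10 ^+ pickle ((j, i) : 'I_n * nat) * t)))).
rewrite (_ : (1 - 2^-1)^-1 = 2); last by field.
rewrite -/(zigzag _) => s2; rewrite normrM gtr0_norm// -[leRHS]mulr1 ler_pM2l//.
by rewrite ler_norml; apply/andP; split; rewrite /zigzag; lra.
Qed.

Lemma measurable_curve n (K : R) (h : R -> R) : {homo h : u v / u <= v} ->
  measurable_fun setT (fun u : measurableTypeR R => curve n K (h u)).
Proof.
move=> hm; apply: measurable_fun_matrix => i j; rewrite (ord1 j).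
have mc : measurable_fun setT (fun t : R => curve n K t i 0).
  by apply: continuous_measurable_fun; exact: curve_continuous.
exact: (measurableT_comp mc (nondecreasing_measurable measurableT hm)).
Qed.

Lemma input_subsequence (F_ : nat -> probability 'cV[R]_nt R) :
  (forall k, input_laws X (F_ k)) ->
  exists phi : nat -> nat, (forall n, (n <= phi n)%N) /\
    exists2 F, input_laws X F &
      overlap H (F_ (phi n)) @[n --> \oo] --> overlap H F /\
      fine (channel_information H (F_ (phi n))) @[n --> \oo] -->
        fine (channel_information H F).
Proof.
move=> FX; have [K K0 XK] := compact_entry_bound cX.
have mX := measurable_compact.
have maddress : measurable_fun setT (address K : 'cV[R]_nt -> R) := measurable_address K.
pose mixin := isMeasurableFun.Build _ _ _ _ (address K : 'cV[R]_nt -> R) maddress.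
pose s : {mfun 'cV[R]_nt >-> R} := HB.pack (address K : 'cV[R]_nt -> R) mixin.
have C0 : 0 <= 2 :> R by [].
have sC x : 0 <= s x <= 2 by exact: address_bounds.
pose Q k : R -> R := @quantile _ _ R (F_ k) s 2.
have [phi [phin [g g_homo g_ae]]] := @helly_selection R Q 2
  (fun k => @quantile_homo _ _ R (F_ k) s 2 C0) (fun k => @quantile_bounds _ _ R (F_ k) s 2 C0).
exists phi; split => //.
pose xi_ k (u : measurableTypeR R) : 'cV[R]_nt := curve nt K (Q (phi k) u).
pose xi (u : measurableTypeR R) : 'cV[R]_nt := curve nt K (g u).
have mxi_ k : measurable_fun setT (xi_ k).
  by apply: measurable_curve; exact: (@quantile_homo _ _ R (F_ (phi k)) s 2 C0).
have mxi : measurable_fun setT xi by exact: measurable_curve.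
have law_ k A : measurable A -> F_ (phi k) A = U (xi_ k @^-1` A).
  move=> mA.
  have mcA : measurable (curve nt K @^-1` A : set R).
    rewrite -[X in measurable X]setTI; have := @measurable_curve nt K id (fun _ _ => id).
    by move/(_ measurableT A mA).
  rewrite [RHS](_ : _ = U (Q (phi k) @^-1` (curve nt K @^-1` A)))//.
  rewrite (@quantile_law _ _ R (F_ (phi k)) s 2 C0 sC _ mcA).
  have msA : measurable (s @^-1` (curve nt K @^-1` A)).
    by rewrite -[Y in measurable Y]setTI; exact: (maddress measurableT _ mcA).
  (* Passing to the address and back along the curve is the identity only on the cube containing
     [X]; the two events therefore agree on [X], which has full measure. *)
  apply: (probability_eq_on mX (FX (phi k)) mA msA).
  apply/seteqP; split => x [Ax Xx]; split => //; move: Ax; rewrite /= /preimage/= curve_address//;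
    by move=> j; exact: XK.
pose mixin2 := isMeasurableFun.Build _ _ _ _ xi mxi.
pose xim : {mfun measurableTypeR R >-> 'cV[R]_nt} := HB.pack xi mixin2.
pose F : probability 'cV[R]_nt R := distribution U xim.
have law A : measurable A -> F A = U (xi @^-1` A) by [].
(* Continuity of the curve turns convergence of quantiles into convergence of vectors, and Lebesgue
   null sets are null for the uniform law. *)
have xi_cvg : {ae U, forall u, forall i, xi_ k u i 0 @[k --> \oo] --> xi u i 0}.
  have [N [mN N0 sN]] := g_ae.
  have UN0 : U N = 0%E.
    by have /null_content_dominatesP := dominates_uniform_prob (@ltr01 R); apply.
  exists N; split => // u /= hu; apply: sN => /= gu; apply: hu => i.
  apply: (@continuous_cvg _ _ _ _ _ (fun k => Q (phi k) u) (fun t => curve nt K t i 0)) => //.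
  exact: curve_continuous.
have xiM_ k u : bounded_image H (image_radius K) (xi_ k u).
  by apply: cube_bounded_image => [|j]; [exact: ltW|exact: curve_bounds].
have xiM u : bounded_image H (image_radius K) (xi u).
  by apply: cube_bounded_image => [|j]; [exact: ltW|exact: curve_bounds].
exists F.
  change (U (xi @^-1` X) = 1%E).
  have mXi : measurable (xi @^-1` X).
    by rewrite -[Y in measurable Y]setTI; exact: (mxi measurableT _ mX).
  apply/(ae_probability1 U mXi).
  (* The limit stays in [X] because [X] is closed and the countably many exceptional sets can be
     discarded together. *)
  have xiX k : {ae U, forall u, X (xi_ k u)}.
    have mXk : measurable (xi_ k @^-1` X).
      by rewrite -[Y in measurable Y]setTI; exact: (mxi_ k measurableT _ mX).
    by apply/(ae_probability1 U mXk); exact: (etrans (esym (law_ k X mX)) (FX (phi k))).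
  have xiX_all : {ae U, forall u, forall k, X (xi_ k u)} by apply/ae_foralln.
  apply: filterS2 xi_cvg xiX_all => u cu Xu.
  have cl : closed X by apply: compact_closed => //; exact: norm_hausdorff.
  have cxi : (fun k => xi_ k u) @ \oo --> xi u.
    by apply: cvg_mx_entries => i j; rewrite (ord1 j).
  by apply: (@closed_cvg _ _ \oo _ (fun k => xi_ k u) X cl _ _ cxi); exact: nearW.
have M0 := image_radius_ge0 (ltW K0).
split.
- exact: (overlap_cvg mxi_ mxi law_ law xi_cvg).
- exact: (channel_information_cvg M0 mxi_ mxi law_ law xiM_ xiM xi_cvg).
Qed.

End input_compactness.

Theorem theorem5 (R : realType) (nt nr : nat) (X : set 'cV[R]_nt)
    (H : 'M[R]_(nr, nt)) :
  convex_set X -> compact X -> X 0 ->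
  exists C B : \bar R,
    [/\ is_capacity X H C,
        is_max [set (overlap_bound H F)%:E | F in input_laws X] B
      & (B <= C)%E].
Proof.
move=> _ cX X0; have [K K0 XK] := compact_entry_bound cX.
have mX := measurable_compact cX; have M0 := image_radius_ge0 H (ltW K0).
have FM F : input_laws X F -> F (bounded_image H (image_radius H K)) = 1%E.
  apply: probability1_sub => //; first exact: measurable_bounded_image.
  by move=> x Xx; apply: cube_bounded_image => [|j]; [exact: ltW|exact: XK].
have infoE F : input_laws X F ->
    channel_information H F = (fine (channel_information H F))%:E.
  by move=> /FM FF; rewrite (channel_information_fine M0 FF).
have nonempty : input_laws X !=set0.
  exists (\d_(0 : 'cV[R]_nt) : probability 'cV[R]_nt R).
  by rewrite /input_laws/= diracE mem_set.
have [F1 X1 max1] : exists2 F, input_laws X F & forall G, input_laws X G ->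
    fine (channel_information H G) <= fine (channel_information H F).
  apply: (attained_max nonempty) => F_ FX.
  have [phi [p [F XF [_ c]]]] := input_subsequence H cX FX.
  by exists phi; split => //; exists F.
(* Negation turns the least overlap into a maximum. *)
have [F2 X2 max2] : exists2 F, input_laws X F &
    forall G, input_laws X G -> - fine (overlap H G) <= - fine (overlap H F).
  apply: (attained_max nonempty) => F_ FX.
  have [phi [p [F XF [c _]]]] := input_subsequence H cX FX.
  exists phi; split => //; exists F => //; apply: cvgN; apply: fine_cvg.
  by rewrite overlap_fin.
exists (channel_information H F1), (overlap_bound H F2)%:E; split.
- split; first by exists F1.
  by move=> _ [G XG <-]; rewrite (infoE G XG) (infoE F1 X1) lee_fin; exact: max1.
- split; first by exists F2.
  move=> _ [G XG <-]; rewrite lee_fin /overlap_bound /log2_plus.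
  (* On positive overlaps the bound is antitone, so a law of least overlap maximises it. *)
  have v1 := overlap_gt0 (FM F2 X2); have v2 := overlap_gt0 (FM G XG).
  have ln2 : 0 < ln 2 :> R by rewrite ln_gt0// ltr1n.
  have p0 : 0 < (2 / expR 1) `^ (nr%:R / 2) :> R by rewrite powR_gt0// divr_gt0 ?expR_gt0.
  apply: le_max2 => //; rewrite /log2 ler_pM2r ?invr_gt0// ler_ln ?posrE ?mulr_gt0 ?invr_gt0//.
  by rewrite ler_pM2l// lef_pV2 ?posrE//; have := max2 G XG; rewrite lerN2.
(* The two maximising laws may differ: the bound at [F2] is at most the information of [F2], which
   is at most that of [F1]. *)
- apply: le_trans (overlap_bound_le M0 (FM F2 X2)) _.
  by rewrite (infoE F2 X2) (infoE F1 X1) lee_fin; exact: max1.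
Qed.
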